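(* Assume the hypotheses (B0)-(B3) listed in the context. If the relative boundary $\partial S_+$ of the set $S_+=\mathcal{C}\cap S$ (its boundary in the unit sphere $S$ of $\mathbb{R}^d$) is $C^1$ and $m\in\mathcal{C}$, then $\mathbb{E}_x(\tau)=\infty$ for all $x\in E$.
   Context: $\mu$ is a probability measure on $\mathbb{Z}^d$; $(X(t))$ is the homogeneous random walk on $\mathbb{Z}^d$ with $\mathbb{P}_x(X(1)=y)=\mu(y-x)$, where $\mathbb{P}_x,\mathbb{E}_x$ refer to $X(0)=x$. $\mathcal{C}\subset\mathbb{R}^d$ is a cone, $E=\mathcal{C}\cap\mathbb{Z}^d$, $\tau=\inf\{t\ge0:X(t)\notin\mathcal{C}\}$, and $(Z(t))$ is a copy of $(X(t))$ killed at time $\tau$: the sub-stochastic Markov chain on $E$ with transition probabilities $p(x,y)=\mu(y-x)$, $x,y\in E$. Hypotheses. (B0) $\mathcal{C}$ is the closure of an open convex cone $\mathcal{C}^\circ\subset\mathbb{R}^d$ having a vertex at $0$. (B1) $(Z(n))$ is transient on $E$, and there are $\kappa_0>0$ and a finite set $\mathcal{E}_0\subset\mathbb{Z}^d$ such that (a) $\mu(x)>0$ for all $x\in\mathcal{E}_0$; (b) for any $x\ne y$, $x,y\in E$, there is a sequence $x_0,\dots,x_n\in E$ with $x_0=x$, $x_n=y$, $n\le\kappa_0|y-x|$, such that $x_j-x_{j-1}\in\mathcal{E}_0$ for all $j\in\{1,\dots,n\}$. (B2) $R(\alpha)=\sum_{x\in\mathbb{Z}^d}\exp(\alpha\cdot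 x)\mu(x)$ is finite in a neighborhood of the set $D=\{\alpha\in\mathbb{R}^d:R(\alpha)\le1\}$. (B3) $m=\sum_{x\in\mathbb{Z}^d}x\,\mu(x)\ne0$. *)

(* Defs.v *)
From HB Require Import structures.
From mathcomp Require Import all_boot all_order all_algebra.
From mathcomp Require Import all_classical all_reals all_analysis.
Set Implicit Arguments.
Unset Strict Implicit.
Unset Printing Implicit Defensive.
Import Order.TTheory GRing.Theory Num.Theory.
Import numFieldNormedType.Exports.
Local Open Scope classical_set_scope.
Local Open Scope ring_scope.

Definition lattice (d : nat) := 'rV[int]_d.

HB.instance Definition _ d := GRing.Zmodule.on (lattice d).
HB.instance Definition _ d := Countable.on (lattice d).
HB.instance Definition _ d := isPointed.Build (lattice d) 0.
HB.instance Definition _ d := @isMeasurable.Build default_measure_display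
  (lattice d) discrete_measurable discrete_measurable0
  discrete_measurableC discrete_measurableU.

Section Euclidean.
Context {R : realType} {d : nat}.
Implicit Types (a b u v : 'rV[R]_d) (A C : set 'rV[R]_d).

Definition real_vec (x : lattice d) : 'rV[R]_d := map_mx intr (x : 'rV[int]_d).

Definition dot a b : R := \sum_(i < d) a ord0 i * b ord0 i.

(* The library norm on ['rV[R]_d] is the maximum norm; it induces the same
   topology, but the unit sphere has to be the Euclidean one. *)
Definition enorm a : R := Num.sqrt (dot a a).

Definition sphere : set 'rV[R]_d := [set u | enorm u = 1].

(* The sphere is closed, so closures taken in ['rV[R]_d] or in the sphere
   coincide for subsets of the sphere. *)
Definition sphere_boundary A : set 'rV[R]_d :=
  closure A `&` closure (sphere `\` A).

Definition C1_on (U : set 'rV[R]_d) (f : 'rV[R]_d -> R) : Prop :=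
  forall a, U a -> forall j : 'I_d,
    derivable f a (delta_mx ord0 j) /\
    {for a, continuous ('D_(delta_mx ord0 j) f)}.

(* [B] is a C^1 embedded hypersurface of the sphere: near each of its points
   it is the zero set in the sphere of a C^1 function whose derivative does
   not vanish on the tangent space [u^\perp] of the sphere. *)
Definition C1_sphere_hypersurface (B : set 'rV[R]_d) : Prop :=
  forall u, B u -> exists (U : set 'rV[R]_d) (f : 'rV[R]_d -> R),
    [/\ open U, U u, C1_on U f,
        B `&` U = [set v | sphere v /\ f v = 0] `&` U
      & exists w, dot u w = 0 /\ 'D_w f u != 0].

(* A cone with vertex at 0 is a set invariant under positive dilations. *)
Definition convex_cone (A : set 'rV[R]_d) : Prop :=
  @convex_set R 'rV[R]_d A /\ (forall a (t : R), A a -> 0 < t -> A (t *: a)).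

Definition closed_solid_cone C : Prop :=
  exists A, [/\ open A, A !=set0, convex_cone A & C = closure A].

Definition lattice_points C : set (lattice d) := [set x | C (real_vec x)].

Section Walk.
Variable mu : probability (lattice d) R.

Definition laplace (alpha : 'rV[R]_d) : \bar R :=
  (\esum_(x in [set: lattice d])
     ((expR (dot alpha (real_vec x)))%:E * mu [set x]))%E.

Definition laplace_finite_near_sublevel : Prop :=
  exists U : set 'rV[R]_d,
    [/\ open U, [set alpha | (laplace alpha <= 1)%E] `<=` U
      & forall alpha, U alpha -> (laplace alpha < +oo)%E].

(* Coordinatewise; the integral against the discrete measure [mu] is the sum
   of the [x_i * mu(x)]. *)
Definition mean : 'rV[R]_d :=
  \row_(i < d) \int[mu]_x ((x : 'rV[int]_d) ord0 i)%:~R.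

Section Process.
Context {disp : measure_display} {Omega : measurableType disp}.
Variable P : lattice d -> probability Omega R.
Variable X : nat -> {mfun Omega >-> lattice d}.

(* [X] is, under each [P x], the Markov chain started at [x] with transition
   probabilities [mu (z - y)]. *)
Definition random_walk : Prop := forall x : lattice d,
  P x [set w | X 0 w = x] = 1%E /\
  forall (n : nat) (p : nat -> lattice d),
    P x [set w | forall k, (k <= n.+1)%N -> X k w = p k] =
    (P x [set w | forall k, (k <= n)%N -> X k w = p k] *
      mu [set (p n.+1 - p n)%R])%E.

End Process.

Definition chains_of_steps C : Prop :=
  exists (kappa : R) (E0 : set (lattice d)),
    [/\ 0 < kappa, finite_set E0,
        (forall z, E0 z -> (0 < mu [set z])%E)
      & forall x y, lattice_points C x -> lattice_points C y -> x <> y ->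
        exists (n : nat) (p : nat -> lattice d),
          [/\ p 0%N = x, p n = y, n%:R <= kappa * enorm (real_vec (y - x)),
              (forall j, (j <= n)%N -> lattice_points C (p j))
            & (forall j, (j < n)%N -> E0 (p j.+1 - p j))]].

End Walk.

Section Killed.
Context {disp : measure_display} {Omega : measurableType disp}.
Variables (C : set 'rV[R]_d) (X : nat -> {mfun Omega >-> lattice d}).

Definition exit_time (w : Omega) : \bar R :=
  ereal_inf [set (n%:R)%:E | n in [set n | ~ C (real_vec (X n w))]].

(* [None] is the cemetery. *)
Definition killed_walk (n : nat) (w : Omega) : option (lattice d) :=
  if ((n%:R)%:E < exit_time w)%E then Some (X n w) else None.

Definition killed_walk_transient (P : lattice d -> probability Omega R) :=
  forall x, lattice_points C x ->
    (P x [set w | exists2 n, (0 < n)%N & killed_walk n w = Some x] < 1)%E.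

End Killed.

End Euclidean.

(* Main.v *)
Require Import Defs.
From HB Require Import structures.
From mathcomp Require Import all_boot all_order all_algebra.
From mathcomp Require Import all_classical all_reals all_analysis.
From mathcomp Require Import measurable_realfun zify ring lra.

(** Only the law of the exit time [tau] matters.  Let [Q f (x)] be the
    expectation of [f (X 1)] on the event that the walk started at [x] is in
    the cone at time 1 ([killed_step]).  Then [P_x (tau > n) = Q^n 1 (x)], so
    that [E_x tau] is the sum of the series of the [Q^n 1 (x)].  Two lattice
    points of the cone are joined by finitely many steps of positive
    probability, all inside the cone; hence the divergence of this series at
    one point [x] implies its divergence at every other ([finite_life_chain]),
    and [x] may be chosen deep inside the cone.

    Divergence comes from a subsolution, a function [G] of time and space with
    [G N y <= Q g y] on the cone as soon as [g] is nonnegative and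
    [G N.+1 <= g] there.  By induction [G s x <= Q^n f (x)] for all [n]
    and every nonnegative [f] above all the [G N] ([subsolution_le]).  Write
    [m] for the mean step and [T = y - N m] for the fluctuation at time [N].

    If [m] is interior to the cone, a point [y] outside the cone at time [N]
    has [|T| >= r N], and
    [G N y = 1 - (|T|^2 / N^2 + E|X 1 - X 0 - m|^2 / N) / r^2] works: it is
    nonpositive outside the cone and, being linear in [|T|^2], it can be
    propagated exactly.  For [s] large it is at least 1/2 near [s m], so the
    survival probabilities do not tend to 0 ([interior_drift_survives]).

    If [m] is on the boundary, the C^1 hypothesis provides a vector [nu]
    orthogonal to [m], nonnegative on the cone, such that the half-space
    [nu . w >= 0] is the tangent cone at [m] ([tangent_halfspace]): a point
    [y] outside the cone with [Y = nu . y > 0] satisfies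
    [Y^2 <= e |T|^2 + K |T|^4 / N^2], where [e] is as small as desired and [K]
    depends on [e].  The process [Y] is a centred random walk of variance
    [v > 0], so [G N y = Y^2 - e |T|^2 - K |T|^4 / N^2 - M] has drift at least
    [v / 4] when [e] is small and [N], [M] are large.  At the exit from the
    cone only an overshoot below the hyperplane [Y = 0] can make it positive,
    and the constant [M] pays for it ([boundary_profile_step]).  Therefore
    [E_x (Y(X_n)^2; tau > n)] stays above a positive constant.

    Finiteness of [E_x tau] would contradict this ([square_vanishes]).  After
    a time [k], the stopped martingale [Y(X)] gains at most [v] times the
    tail of the series of survival probabilities in mean square, so for [k]
    large [Y(X_n)^2] may be replaced by [Y(X_k)^2] on [tau > n] up to a small
    error and a factor 2, and [P_x (tau > n)] tends to 0 when [n] does to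
    infinity. *)

Set Implicit Arguments.
Unset Strict Implicit.
Unset Printing Implicit Defensive.
Import Order.TTheory GRing.Theory Num.Theory.
Import numFieldNormedType.Exports.
Local Open Scope classical_set_scope.
Local Open Scope ring_scope.

(** * Euclidean dot product and norm *)
Section EuclideanNorm.
Context {R : realType} {d : nat}.
Implicit Types (a b c u v w : 'rV[R]_d) (t : R).

Lemma dotC a b : dot a b = dot b a.
Proof. by apply: eq_bigr => i _; rewrite mulrC. Qed.

Lemma dotDl a b c : dot (a + b) c = dot a c + dot b c.
Proof.
by rewrite /dot -big_split/=; apply: eq_bigr => i _; rewrite mxE mulrDl.
Qed.

Lemma dotZl t a b : dot (t *: a) b = t * dot a b.
Proof. by rewrite /dot mulr_sumr; apply: eq_bigr => i _; rewrite mxE mulrA. Qed.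

Lemma dotDr a b c : dot a (b + c) = dot a b + dot a c.
Proof. by rewrite dotC dotDl !(dotC a). Qed.

Lemma dotZr t a b : dot a (t *: b) = t * dot a b.
Proof. by rewrite dotC dotZl dotC. Qed.

Lemma dotNl a b : dot (- a) b = - dot a b.
Proof. by rewrite -scaleN1r dotZl mulN1r. Qed.

Lemma dotNr a b : dot a (- b) = - dot a b.
Proof. by rewrite dotC dotNl dotC. Qed.

Definition dotE := (dotDl, dotDr, dotNl, dotNr, dotZl, dotZr).

Lemma dot_ge0 a : 0 <= dot a a.
Proof. by apply: sumr_ge0 => i _; rewrite -expr2 sqr_ge0. Qed.

Lemma coord_sqr_le_dot a i : a ord0 i ^+ 2 <= dot a a.
Proof.
rewrite /dot (bigD1 i)//= -expr2 lerDl.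
by apply: sumr_ge0 => j _; rewrite -expr2 sqr_ge0.
Qed.

Lemma dot_eq0 a : dot a a = 0 -> a = 0.
Proof.
move=> a0; apply/rowP => i; rewrite mxE.
by have := coord_sqr_le_dot a i; rewrite a0 le_eqVlt ltNge sqr_ge0 orbF sqrf_eq0
  => /eqP.
Qed.

Lemma dot_gt0 a : a != 0 -> 0 < dot a a.
Proof.
move=> a0; rewrite lt_neqAle dot_ge0 andbT eq_sym.
by apply: contra_neq a0 => /dot_eq0.
Qed.

Lemma dot_sqr_le a b : dot a b ^+ 2 <= dot a a * dot b b.
Proof.
have [->|b0] := eqVneq b 0.
  by rewrite -(scale0r (0 : 'rV[R]_d)) !dotE !mul0r !mulr0 expr2 mul0r.
have := dot_ge0 (dot b b *: a - dot a b *: b).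
rewrite !dotE (dotC b a); set x := dot a b; set p := dot a a.
have := dot_gt0 b0; set q := dot b b => q0.
rewrite [leRHS](_ : _ = q * (p * q - x ^+ 2)); last by ring.
by rewrite pmulr_rge0// subr_ge0.
Qed.

Lemma dot_sub_sqr_le a b :
  dot (a - b) (a - b) <= 2 * dot a a + 2 * dot b b.
Proof. by have := dot_ge0 (a + b); rewrite !dotE (dotC b a); lra. Qed.

(** The term linear in [b] is kept exact, because it vanishes in expectation
    when [b] is a centred step; all the other terms may be overestimated. *)
Lemma dot_add_quartic_le a b : dot (a + b) (a + b) ^+ 2 <=
  dot a a ^+ 2 + 4 * dot a a * dot a b + 8 * dot a a * dot b b + 3 * dot b b ^+ 2.
Proof.
rewrite !dotE (dotC b a); have := dot_sqr_le a b.
set p := dot a a; set x := dot a b; set q := dot b b => xpq.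
have := sqr_ge0 (x - q); rewrite !expr2 in xpq *; lra.
Qed.

Lemma enorm_ge0 a : 0 <= enorm a. Proof. exact: sqrtr_ge0. Qed.

Lemma sqr_enorm a : enorm a ^+ 2 = dot a a.
Proof. by rewrite sqr_sqrtr// dot_ge0. Qed.

Lemma dot_le_enorm a b : `|dot a b| <= enorm a * enorm b.
Proof.
rewrite -(@ler_pXn2r _ 2)// ?nnegrE ?mulr_ge0 ?enorm_ge0//.
by rewrite exprMn !sqr_enorm real_normK ?num_real// dot_sqr_le.
Qed.

Lemma enormD a b : enorm (a + b) <= enorm a + enorm b.
Proof.
rewrite -(@ler_pXn2r _ 2)// ?nnegrE ?addr_ge0 ?enorm_ge0//.
rewrite sqrrD !sqr_enorm !dotE (dotC b a).
have := le_trans (ler_norm _) (dot_le_enorm a b).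
rewrite -mulr_natr; lra.
Qed.

Lemma enormZ t a : enorm (t *: a) = `|t| * enorm a.
Proof.
by rewrite /enorm !dotE mulrA -expr2 sqrtrM ?sqr_ge0// sqrtr_sqr.
Qed.

Lemma enormN a : enorm (- a) = enorm a.
Proof. by rewrite -scaleN1r enormZ normrN1 mul1r. Qed.

Lemma enorm0 : enorm (0 : 'rV[R]_d) = 0.
Proof. by rewrite -(scale0r (0 : 'rV[R]_d)) enormZ normr0 mul0r. Qed.

Lemma enorm_eq0 a : enorm a = 0 -> a = 0.
Proof. by move=> a0; apply: dot_eq0; rewrite -sqr_enorm a0 expr2 mul0r. Qed.

Lemma enorm_gt0 a : a != 0 -> 0 < enorm a.
Proof. by move=> a0; rewrite sqrtr_gt0 dot_gt0. Qed.

Lemma norm_le_enorm a : `|a| <= enorm a.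
Proof.
rewrite [`|a|]mx_normrE; apply: bigmax_le; first exact: enorm_ge0.
move=> [i j] _ /=; rewrite (ord1 i).
rewrite -(@ler_pXn2r _ 2)// ?nnegrE ?enorm_ge0//.
by rewrite sqr_enorm real_normK ?num_real// coord_sqr_le_dot.
Qed.

Lemma coord_le_norm a i : `|a ord0 i| <= `|a|.
Proof.
by rewrite [`|a|]mx_normrE;
  apply: (@le_bigmax _ _ _ 0 (fun ij => `|a ij.1 ij.2|) (ord0, i)).
Qed.

Lemma enorm_le_norm a : enorm a <= Num.sqrt d%:R * `|a|.
Proof.
rewrite -(@ler_pXn2r _ 2)// ?nnegrE ?mulr_ge0 ?enorm_ge0 ?sqrtr_ge0//.
rewrite sqr_enorm exprMn sqr_sqrtr ?ler0n// /dot.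
rewrite mulr_natl -[d in _ *+ d]card_ord -sumr_const.
apply: ler_sum => i _; rewrite -expr2 -real_normK ?num_real//.
by rewrite ler_pXn2r ?nnegrE// coord_le_norm.
Qed.

(** The topology of row vectors is given by the maximum norm; all the geometry
    below is done with Euclidean balls instead. *)
Lemma nbhs_enormP a (A : set 'rV[R]_d) :
  nbhs a A <-> exists2 r, 0 < r & forall y, enorm (y - a) < r -> A y.
Proof.
split.
  move=> /nbhs_ballP[r /= r0 rA]; exists r => // y yr; apply: rA.
  rewrite -ball_normE /= distrC; exact: le_lt_trans (norm_le_enorm _) yr.
move=> [r r0 rA]; apply/nbhs_ballP.
have s0 : 0 < Num.sqrt d%:R + 1 :> R by rewrite ltr_wpDl// sqrtr_ge0.
exists (r / (Num.sqrt d%:R + 1)); first by rewrite /= divr_gt0.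
move=> y; rewrite -ball_normE /= distrC => yr; apply: rA.
apply: le_lt_trans (enorm_le_norm _) _.
have [->|y0] := eqVneq (y - a) 0; first by rewrite normr0 mulr0.
rewrite ltr_pdivlMr// mulrC in yr; apply: lt_trans yr.
by rewrite ltr_pM2r ?normr_gt0// ltrDl.
Qed.

End EuclideanNorm.

(** * First-order expansion of C^1 functions *)

Section C1.
Context {R : realType} {d : nat}.
Implicit Types (a b u v y h : 'rV[R]_d) (t c : R).

Lemma is_derive_line (f : 'rV[R]_d -> R) p v t :
  derivable f (p + t *: v) v ->
  is_derive t (1 : R) (fun s : R => f (p + s *: v)) ('D_v f (p + t *: v)).
Proof.
move=> fv; have E :
    (fun s : R => s^-1 *: (f (p + (s *: (1 : R) + t) *: v) - f (p + t *: v)))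
   = (fun s : R => s^-1 *: (f (s *: v + (p + t *: v)) - f (p + t *: v))).
  apply/funext => s; congr (_ *: (f _ - _)).
  by rewrite (_ : s *: (1 : R) = s) ?scalerDl 1?addrCA// /GRing.scale /= mulr1.
split; first by rewrite /derivable /= E.
by rewrite /derive /= E.
Qed.

Lemma MVT_line (f : 'rV[R]_d -> R) p v c :
  (forall t, `|t| <= `|c| -> derivable f (p + t *: v) v) ->
  exists2 t, `|t| <= `|c| & f (p + c *: v) - f p = c * 'D_v f (p + t *: v).
Proof.
move=> fv; pose g (s : R) := f (p + s *: v).
have dg t : `|t| <= `|c| -> is_derive t 1 g ('D_v f (p + t *: v)).
  by move=> /fv; exact: is_derive_line.
have [c0|c0] := leP 0 c.
  have itvc t : t \in `[0, c] -> `|t| <= `|c|.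
    by rewrite in_itv/= => /andP[t0 tc]; rewrite !ger0_norm.
  have [|||t tc] := @MVT_segment R g (fun t => 'D_v f (p + t *: v)) 0 c => //.
  - by move=> t /subset_itv_oo_cc/itvc/dg.
  - by apply: derivable_within_continuous => t /itvc/dg[].
  - by rewrite /g scale0r addr0 subr0 mulrC => E; exists t; [exact: itvc|].
have itvc t : t \in `[c, 0] -> `|t| <= `|c|.
  by rewrite in_itv/= => /andP[t0 tc]; rewrite !ler0_norm ?lerN2// ltW.
have [|||t tc] := @MVT_segment R g (fun t => 'D_v f (p + t *: v)) c 0.
- exact: ltW.
- by move=> t /subset_itv_oo_cc/itvc/dg.
- by apply: derivable_within_continuous => t /itvc/dg[].
- rewrite /g scale0r addr0 sub0r => E; exists t; first exact: itvc.
  by rewrite -opprB E mulrN opprK mulrC.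
Qed.

Definition gradient (f : 'rV[R]_d -> R) u : 'rV[R]_d :=
  \row_j 'D_(delta_mx ord0 j) f u.

Let trunc k h : 'rV[R]_d := \row_i (if (i < k)%N then h ord0 i else 0).

(** The increment is split along the coordinates, one at a time.  The mean
    value theorem turns each piece into a partial derivative at a point close
    to [u], which differs little from the one at [u] by continuity. *)
Lemma C1_first_order (U : set 'rV[R]_d) (f : 'rV[R]_d -> R) u :
  open U -> U u -> C1_on U f -> forall e, 0 < e ->
  exists2 r, 0 < r & forall h, enorm h < r ->
    `|f (u + h) - f u - dot (gradient f u) h| <= e * enorm h.
Proof.
move=> oU Uu C1f.
suff H e : 0 < e -> exists2 r, 0 < r & forall h, enorm h < r ->
    `|f (u + h) - f u - dot (gradient f u) h| <= e * \sum_(j < d) `|h ord0 j|.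
  move=> e e0; have d0 : 0 < d%:R + 1 :> R by rewrite ltr_wpDl.
  have [r r0 rP] := H _ (divr_gt0 e0 d0).
  exists r => // h /rP/le_trans; apply.
  rewrite -mulrA; apply: ler_wpM2l; first exact: ltW.
  rewrite mulrC ler_pdivrMr// mulrDr mulr1 mulr_natr -[d in _ *+ d]card_ord.
  rewrite -sumr_const; apply: ler_wpDr; first exact: enorm_ge0.
  apply: ler_sum => j _; apply: le_trans (norm_le_enorm h).
  exact: coord_le_norm.
move=> e0.
have near_D : \forall y \near u, forall j : 'I_d,
    `|'D_(delta_mx ord0 j) f y - 'D_(delta_mx ord0 j) f u| <= e.
  apply: (filter_forall (F := nbhs u)) => j; have [_ cf] := C1f _ Uu j.
  move/cvgrPdist_le: cf => /(_ _ e0); apply: filterS => y.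
  by rewrite distrC.
have : nbhs u (U `&` [set y | forall j : 'I_d,
    `|'D_(delta_mx ord0 j) f y - 'D_(delta_mx ord0 j) f u| <= e]).
  by apply: filterI => //; exact: open_nbhs_nbhs.
move=> /nbhs_ballP[r /= r0 rP].
exists r => // h hr.
have {hr} {}rP y : (forall i, `|y ord0 i - u ord0 i| <= `|h ord0 i|) ->
    U y /\ forall j : 'I_d,
    `|'D_(delta_mx ord0 j) f y - 'D_(delta_mx ord0 j) f u| <= e.
  move=> yh; apply: rP; rewrite -ball_normE /= distrC.
  apply: le_lt_trans (le_lt_trans (norm_le_enorm h) hr).
  rewrite [`|y - u|]mx_normrE; apply: bigmax_le => //.
  move=> [i j] _ /=; rewrite (ord1 i) !mxE.
  by apply: le_trans (yh j) _; exact: coord_le_norm.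
suff H k : (k <= d)%N -> `|f (u + trunc k h) - f u -
     \sum_(j < d | (j < k)%N) gradient f u ord0 j * h ord0 j| <=
     e * \sum_(j < d | (j < k)%N) `|h ord0 j|.
  have := H d (leqnn d).
  have sumT (F : 'I_d -> R) : \sum_(j < d | (j < d)%N) F j = \sum_(j < d) F j.
    by apply: eq_bigl => i; rewrite ltn_ord.
  rewrite !sumT.
  by rewrite (_ : trunc d h = h)//; apply/rowP => i; rewrite mxE ltn_ord.
elim: k => [|k IH] kd.
  rewrite (_ : trunc 0 h = 0); last by apply/rowP => i; rewrite !mxE ltn0.
  by rewrite !big_pred0 => [|i|i]; rewrite ?ltn0// addr0 !subrr normr0 mulr0.
pose j := Ordinal kd.
have ltS (i : 'I_d) : (i < k.+1)%N && (i != j) = (i < k)%N.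
  by rewrite ltnS -val_eqE /= andbC -ltn_neqAle.
have -> : trunc k.+1 h = trunc k h + h ord0 j *: delta_mx ord0 j.
  apply/rowP => i; rewrite !mxE eqxx /= ltnS leq_eqVlt.
  rewrite -[(i == k :> nat)]/(i == j).
  have [->|ij] /= := eqVneq i j; first by rewrite ltnn mulr1 add0r.
  by rewrite mulr0 addr0.
rewrite addrA; set p := u + trunc k h.
have near_p t : `|t| <= `|h ord0 j| ->
    forall i, `|(p + t *: delta_mx ord0 j) ord0 i - u ord0 i| <= `|h ord0 i|.
  move=> th i; rewrite !mxE eqxx /= addrAC [u _ _ + _]addrC addrK.
  case: eqVneq => [->|ij] /=; first by rewrite ltnn mulr1 add0r.
  by rewrite mulr0 addr0; case: ifP => // _; rewrite normr0.
have [t th] : exists2 t, `|t| <= `|h ord0 j| &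
    f (p + h ord0 j *: delta_mx ord0 j) - f p =
    h ord0 j * 'D_(delta_mx ord0 j) f (p + t *: delta_mx ord0 j).
  apply: MVT_line => t /near_p/rP[Ut _]; exact: (C1f _ Ut j).1.
move=> E; rewrite (bigD1 j) ?leqnn//= (eq_bigl _ _ ltS).
rewrite [in leRHS](bigD1 j) ?leqnn//= (eq_bigl _ _ ltS).
set S1 := \sum_(_ < _ | _) _ * _; set S2 := \sum_(_ < _ | _) `|_|.
rewrite (_ : _ - _ - _ = h ord0 j * ('D_(delta_mx ord0 j) f (p + t *: delta_mx ord0 j)
   - gradient f u ord0 j) + (f p - f u - S1)); last first.
  by rewrite mulrBr -E; ring.
rewrite [leRHS]mulrDr; apply: le_trans (ler_normD _ _) (lerD _ (IH (ltnW kd))).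
rewrite normrM mulrC; apply: ler_wpM2r => //.
by rewrite mxE; have [_] := rP _ (near_p _ th); apply.
Qed.

Lemma derive_gradient (U : set 'rV[R]_d) (f : 'rV[R]_d -> R) u w :
  open U -> U u -> C1_on U f -> 'D_w f u = dot (gradient f u) w.
Proof.
move=> oU Uu C1f; apply/cvg_lim => //.
apply/cvgrPdist_le => e e0.
have w0 : 0 < enorm w + 1 by rewrite ltr_wpDl// enorm_ge0.
have [r r0 rP] := C1_first_order oU Uu C1f (divr_gt0 e0 w0).
near=> t.
have t0 : t != 0 by near: t; exact: nbhs_dnbhs_neq.
have tw : enorm (t *: w) < r.
  rewrite enormZ; apply: le_lt_trans (_ : `|t| * (enorm w + 1) < r).
    by rewrite ler_wpM2l// lerDl.
  rewrite -ltr_pdivlMr//; near: t.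
  by apply: dnbhs0_lt; rewrite divr_gt0.
have := rP _ tw; rewrite dotZr enormZ => H.
rewrite distrC /= [t *: w + u]addrC.
have -> : t^-1 *: (f (u + t *: w) - f u) - dot (gradient f u) w =
   t^-1 * (f (u + t *: w) - f u - t * dot (gradient f u) w).
  by rewrite [RHS]mulrBr mulKf.
rewrite normrM normfV ler_pdivrMl ?normr_gt0//.
apply: le_trans H _.
rewrite mulrCA ler_pM2l ?normr_gt0// -mulrA.
apply: ler_piMr; first exact: ltW.
by rewrite mulrC ler_pdivrMr// mul1r lerDl.
Unshelve. all: by end_near. Qed.
End C1.

(** * The tangent half-space of a cone with C^1 boundary *)

Section Cones.
Context {R : realType} {d : nat}.
Implicit Types (a b g m u v w x y z h : 'rV[R]_d) (s t c : R) (A C : set 'rV[R]_d).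

(** Closed convex cones, convexity being expressed by stability under sums. *)
Definition closed_cone C :=
  [/\ closed C, (forall t x, 0 < t -> C x -> C (t *: x))
    & forall x y, C x -> C y -> C (x + y)].

Lemma convex_cone_add A x y : convex_cone A -> A x -> A y -> A (x + y).
Proof.
move=> [cA sA] Ax Ay.
have h0 : (0 : R) <= 2^-1 by rewrite invr_ge0 ler0n.
have h1 : (2^-1 : R) <= 1 by rewrite invf_le1 ?ler1n ?ltr0n.
have /set_mem xy := cA x y (Itv01 h0 h1) (mem_set Ax) (mem_set Ay).
have {xy} : A (2^-1 *: x + (1 - 2^-1) *: y) by exact: xy.
move=> /sA/(_ (ltr0n _ 2)); congr A; rewrite scalerDr !scalerA.
have -> : 2 * (1 - 2^-1) = 1 :> R by lra.
by rewrite divff ?scale1r ?pnatr_eq0.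
Qed.

Lemma closed_solid_cone_closed C : closed_solid_cone C -> closed_cone C.
Proof.
move=> [A [oA A0 cA ->]]; split; first exact: closed_closure.
- move=> t x t0 cx B /nbhs_enormP[r r0 rB].
  have [|y [Ay]] := cx [set y | enorm (y - x) < r / t].
    by apply/nbhs_enormP; exists (r / t) => //; rewrite divr_gt0.
  move=> /= yx; exists (t *: y); split; first exact: cA.2.
  apply: rB; rewrite -scalerBr enormZ gtr0_norm// mulrC -ltr_pdivlMr//.
- move=> x y cx cy B /nbhs_enormP[r r0 rB].
  have r2 : 0 < r / 2 by rewrite divr_gt0.
  have [|x' [Ax /= x'x]] := cx [set z | enorm (z - x) < r / 2].
    by apply/nbhs_enormP; exists (r / 2).
  have [|y' [Ay /= y'y]] := cy [set z | enorm (z - y) < r / 2].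
    by apply/nbhs_enormP; exists (r / 2).
  exists (x' + y'); split; first exact: convex_cone_add.
  apply: rB; rewrite opprD addrACA; apply: le_lt_trans (enormD _ _) _.
  by rewrite (splitr r) ltrD.
Qed.

Lemma closed_solid_cone_interior C : closed_solid_cone C -> C^° !=set0.
Proof.
move=> [A [oA [a Aa] _ ->]]; exists a.
by apply: filterS (@subset_closure _ A) _; exact: open_nbhs_nbhs.
Qed.

Section ClosedCone.
Variable C : set 'rV[R]_d.
Hypothesis coneC : closed_cone C.
Let closedC : closed C. Proof. by case: coneC. Qed.
Let scaleC t x : 0 < t -> C x -> C (t *: x). Proof. by case: coneC => _ + _; apply. Qed.
Let addC x y : C x -> C y -> C (x + y). Proof. by case: coneC => _ _; apply. Qed.

Lemma interior_sub x : C^° x -> C x. Proof. exact: nbhs_singleton. Qed.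

Lemma interior_add a y : C^° a -> C y -> C^° (a + y).
Proof.
move=> /nbhs_enormP[r r0 rC] Cy; apply/nbhs_enormP; exists r => // z zr.
rewrite -(subrK y z); apply: addC => //; apply: rC.
by rewrite -addrA -opprD [y + a]addrC.
Qed.

Lemma interior_scale t a : 0 < t -> C^° a -> C^° (t *: a).
Proof.
move=> t0 /nbhs_enormP[r r0 rC]; apply/nbhs_enormP; exists (t * r).
  exact: mulr_gt0.
move=> z zr; rewrite -(scale1r z) -(@divff _ t) ?gt_eqF// -scalerA.
apply: scaleC => //; apply: rC.
rewrite -(@ltr_pM2l _ t)//; apply: le_lt_trans zr.
by rewrite -{1}(gtr0_norm t0) -enormZ scalerBr scalerA divff ?gt_eqF// scale1r.
Qed.

Lemma interior_perturb a w : C^° a -> exists2 s, 0 < s & C^° (a + s *: w).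
Proof.
move=> Ca; have : nbhs a C^° by apply: open_nbhs_nbhs; split => //;
  exact: open_interior.
move=> /nbhs_enormP[r r0 rC].
have w0 : 0 < enorm w + 1 by rewrite ltr_wpDl// enorm_ge0.
exists (r / (enorm w + 1)); first exact: divr_gt0.
apply: rC; rewrite addrC addKr enormZ gtr0_norm ?divr_gt0//.
by rewrite mulrAC ltr_pdivrMr// ltr_pM2l// ltrDl.
Qed.

Definition unitv y : 'rV[R]_d := (enorm y)^-1 *: y.

Lemma enorm_unitv y : y != 0 -> enorm (unitv y) = 1.
Proof.
move=> y0; rewrite enormZ normfV ger0_norm ?enorm_ge0// mulVf// gt_eqF//.
exact: enorm_gt0.
Qed.

Lemma unitvK y : y != 0 -> enorm y *: unitv y = y.
Proof. by move=> y0; rewrite scalerA divff ?scale1r// gt_eqF// enorm_gt0. Qed.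

Lemma unitv_dist z y : z != 0 -> y != 0 ->
  enorm (unitv z - unitv y) <= 2 * enorm (z - y) / enorm z.
Proof.
move=> z0 y0; have zp := enorm_gt0 z0; have yp := enorm_gt0 y0.
have -> : unitv z - unitv y = ((enorm z)^-1 * (enorm y)^-1) *:
    (enorm y *: (z - y) + (enorm y - enorm z) *: y).
  apply/rowP => i; rewrite !mxE; field.
  by rewrite !gt_eqF.
have [xy yx] : enorm y - enorm z <= enorm (z - y) /\ enorm z - enorm y <= enorm (z - y).
  have := enormD (z - y) y; have := enormD (y - z) z.
  rewrite !subrK -(enormN (y - z)) opprB; split; lra.
rewrite enormZ gtr0_norm ?mulr_gt0 ?invr_gt0//.
rewrite -[leLHS]mulrA [leRHS]mulrC ler_pM2l ?invr_gt0// ler_pdivrMl//.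
apply: le_trans (enormD _ _) _.
rewrite !enormZ (gtr0_norm yp) [2 * _]mulr_natl mulr2n mulrDr lerD2l mulrC ler_pM2l//.
by rewrite ler_norml; apply/andP; split; lra.
Qed.

(** The boundary of a cone is the union of the rays through the relative
    boundary of its trace on the sphere, the vertex apart. *)
Lemma boundary_unitv y : y != 0 -> C y -> ~ C^° y ->
  sphere_boundary (C `&` sphere) (unitv y).
Proof.
move=> y0 Cy nCy; have yp := enorm_gt0 y0; split.
  apply: subset_closure; split; last exact: enorm_unitv.
  by apply: scaleC => //; rewrite invr_gt0.
move=> W /nbhs_enormP[r r0 rW].
pose r1 := Num.min (enorm y / 2) (r * enorm y / 8).
have r10 : 0 < r1 by rewrite lt_min !divr_gt0 ?mulr_gt0.
have [z [zy nCz]] : exists z, enorm (z - y) < r1 /\ ~ C z.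
  apply: contra_notP nCy => H; apply/nbhs_enormP; exists r1 => // z zy.
  by apply: contrapT => nCz; apply: H; exists z.
move: zy; rewrite lt_min => /andP[zy1 zy2].
have zy : enorm y / 2 < enorm z.
  have := enormD (y - z) z; rewrite subrK -(enormN (y - z)) opprB; lra.
have z0 : z != 0.
  by apply/eqP => z0; move: zy; rewrite z0 enorm0; lra.
exists (unitv z); split.
  split; first exact: enorm_unitv.
  by move=> [Cz _]; apply: nCz; rewrite -(unitvK z0); apply: scaleC => //;
    exact: enorm_gt0.
apply: rW; apply: le_lt_trans (unitv_dist z0 y0) _.
rewrite ltr_pdivrMr ?enorm_gt0//.
have H : r * (enorm y / 2) < r * enorm z by rewrite ltr_pM2l.
have := mulr_gt0 r0 yp; lra.
Qed.

(** A connectedness argument: the points of the segment in the cone form a set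
    which is closed in the segment, and also open if none of them is a boundary
    point of the cone. *)
Lemma segment_in_cone (p q : 'rV[R]_d) : C p ->
  (forall t, 0 <= t <= 1 -> C (t *: p + (1 - t) *: q) -> C^° (t *: p + (1 - t) *: q)) ->
  C q.
Proof.
move=> Cp CI; pose phi (t : R) : 'rV[R]_d := t *: p + (1 - t) *: q.
have cphi : continuous phi.
  move=> t; apply: cvgD; apply: cvgZr_tmp => //=; last first.
    by apply: cvgB => //; exact: cvg_cst.
have conn : connected `[(0 : R), 1]%classic by exact: segment_connected.
have /conn E : (`[(0 : R), 1]%classic `&` phi @^-1` C) !=set0.
  exists 1; split => /=; first by rewrite in_itv/= ler01 lexx.
  by rewrite /phi scale1r subrr scale0r addr0.
have /seteqP[_ /(_ 0)] : `[(0 : R), 1]%classic `&` phi @^-1` C = `[(0 : R), 1]%classic.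
  apply: E.
    exists (phi @^-1` C^°); first by apply: open_comp => //; exact: open_interior.
    apply/seteqP; split => t [/= t01 Ct]; split => //.
      by apply: CI => //; move: t01; rewrite in_itv.
    exact: interior_sub.
  by exists (phi @^-1` C) => //; apply: closed_comp.
case; first by rewrite /= in_itv/= lexx ler01.
by rewrite /phi /= scale0r add0r subr0 scale1r.
Qed.

(** For [e] small enough, the part of the convex cone [e |y - u| <= g . y] near
    [u] contains points [u + s a] interior to [C] and, apart from [u], no
    boundary point of [C]; being convex, it lies in [C].  Larger [e] give
    smaller cones. *)
Lemma no_boundary_cone u a g : u != 0 -> dot g u = 0 -> C u -> C^° a -> 0 < dot g a ->
  (forall e, 0 < e -> exists2 r, 0 < r & forall y, y != u -> enorm (y - u) < r ->
     e * enorm (y - u) <= `|dot g y| -> C y -> C^° y) ->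
  forall e, 0 < e -> exists2 r, 0 < r & forall y, enorm (y - u) < r ->
     e * enorm (y - u) <= dot g y -> C y.
Proof.
move=> u0 gu Cu Ca ga nobd e e0.
have a0 : a != 0.
  apply: contraTneq ga => ->.
  by rewrite -(scale0r (0 : 'rV[R]_d)) dotZr mul0r ltxx.
have ap := enorm_gt0 a0.
(* the cone of parameter [e'] contains both [u + s a] and the given cone *)
pose e' := Num.min e (dot g a / enorm a).
have e'0 : 0 < e' by rewrite lt_min e0 divr_gt0.
have [r r0 rP] := nobd _ e'0; exists r => // y yr gy.
have [->//|yu] := eqVneq y u.
have yup : 0 < enorm (y - u) by rewrite enorm_gt0// subr_eq0.
have gy0 : 0 < dot g y by apply: lt_le_trans gy; rewrite mulr_gt0.
pose s := r / (2 * enorm a).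
have s0 : 0 < s by rewrite divr_gt0// mulr_gt0.
have Cp : C (s *: a + u) by apply/interior_sub/interior_add => //;
  exact: interior_scale.
apply: (segment_in_cone Cp) => t /andP[t0 t1]; set q := _ + _.
have gq : dot g q = t * (s * dot g a) + (1 - t) * dot g y.
  by rewrite /q !dotE gu addr0.
have E : q - u = t *: (s *: a) + (1 - t) *: (y - u).
  by apply/rowP => i; rewrite !mxE; ring.
have nq : enorm (q - u) <= t * (s * enorm a) + (1 - t) * enorm (y - u).
  rewrite E; apply: le_trans (enormD _ _) _.
  by rewrite !enormZ !ger0_norm ?subr_ge0// ltW.
have sa : s * enorm a = r / 2 by rewrite /s; field; rewrite gt_eqF.
have gq0 : 0 < dot g q.
  rewrite gq; have [->|tn0] := eqVneq t 0; first by rewrite mul0r add0r subr0 mul1r.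
  have tp : 0 < t by rewrite lt_neqAle eq_sym tn0.
  apply: ltr_pwDl; first by apply: mulr_gt0 => //; exact: mulr_gt0.
  by apply: mulr_ge0; [rewrite subr_ge0|exact: ltW].
apply: rP.
- by apply: contraTneq gq0 => ->; rewrite gu ltxx.
- apply: le_lt_trans nq _; rewrite sa.
  apply: (@le_lt_trans _ _ (t * Num.max (r / 2) (enorm (y - u)) +
    (1 - t) * Num.max (r / 2) (enorm (y - u)))).
    by apply: lerD; apply: ler_wpM2l; rewrite ?subr_ge0// le_max lexx ?orbT.
  by rewrite -mulrDl addrC subrK mul1r gt_max yr andbT; lra.
- rewrite gtr0_norm//; apply: le_trans (ler_wpM2l (ltW e'0) nq) _.
  rewrite gq mulrDr; apply: lerD.
    rewrite mulrCA; apply: ler_wpM2l => //.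
    rewrite mulrCA; apply: ler_wpM2l; first exact: ltW.
    by rewrite -ler_pdivlMr// ge_min lexx orbT.
  rewrite mulrCA; apply: ler_wpM2l; first by rewrite subr_ge0.
  by apply: le_trans gy; rewrite ler_pM2r// ge_min lexx.
Qed.

(** Near [u], the boundary of [C] on the sphere is the zero set of a function
    whose differential on the tangent space of the sphere is [dot g], with [g]
    the tangential part of the gradient.  Away from the hyperplane [g . y = 0]
    the linear term dominates and the function has no zero. *)
Lemma normal_double_cone (u : 'rV[R]_d) :
  C1_sphere_hypersurface (sphere_boundary (C `&` sphere)) ->
  enorm u = 1 -> C u -> ~ C^° u ->
  exists2 g, g != 0 /\ dot g u = 0 &
   (forall e, 0 < e -> exists2 r, 0 < r & forall y, y != u -> enorm (y - u) < r ->
     e * enorm (y - u) <= `|dot g y| -> C y -> C^° y).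
Proof.
move=> hyp u1 Cu nCu.
have u0 : u != 0.
  by apply/eqP => u0; move: u1; rewrite u0 enorm0 => /esym/eqP; rewrite oner_eq0.
have uu : unitv u = u by rewrite /unitv u1 invr1 scale1r.
have duu : dot u u = 1 by rewrite -sqr_enorm u1 expr1n.
have := boundary_unitv u0 Cu nCu; rewrite uu; set B := sphere_boundary _ => Bu.
have [U [f [oU Uu C1f BU [w [uw fw]]]]] := hyp u Bu.
have fu : f u = 0.
  have : (B `&` U) u by [].
  by rewrite BU => -[[]].
have {}fw : dot (gradient f u) w != 0 by rewrite -(derive_gradient w oU Uu C1f).
pose G := dot (gradient f u) u; pose g := gradient f u - G *: u.
have gu : dot g u = 0 by rewrite /g !dotE duu mulr1 subrr.
exists g.
  split=> //; apply: contraNneq fw => g0.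
  have : dot g w = 0 by rewrite g0 -(scale0r (0 : 'rV[R]_d)) dotZl mul0r.
  by rewrite /g !dotE uw mulr0 subr0 => ->.
move=> e e0.
have [r r0 rP] := C1_first_order oU Uu C1f (divr_gt0 e0 (ltr0n _ 8) : 0 < e / 8).
have /nbhs_enormP[r' r'0 r'U] : nbhs u U by exact: open_nbhs_nbhs.
have G0 : 0 < `|G| + 1 by rewrite ltr_wpDl.
pose rho := Num.min (Num.min r r') (e / (8 * (`|G| + 1))).
have rho0 : 0 < rho by rewrite !lt_min r0 r'0 divr_gt0// mulr_gt0.
exists (Num.min (1 / 2) (rho / 8)); first by rewrite lt_min !divr_gt0.
move=> y yu; rewrite lt_min => /andP[yu2 yur] gy Cy.
apply: contrapT => nCy.
have ny : 1 / 2 < enorm y.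
  have := enormD (u - y) y; rewrite subrK -(enormN (u - y)) opprB u1; lra.
have ny' : enorm y < 2.
  have := enormD (y - u) u; rewrite subrK u1; lra.
have y0 : y != 0 by apply/eqP => y0; move: ny; rewrite y0 enorm0; lra.
have yp : 0 < enorm y by lra.
have Bv := boundary_unitv y0 Cy nCy; set v := unitv y in Bv.
(* [h] is kept opaque: rewriting must not expand it as a difference *)
have [h hE] : exists h, h = v - u by exists (v - u).
have vE : u + h = v by rewrite hE addrC subrK.
have hy : enorm h <= 4 * enorm (y - u).
  have := unitv_dist y0 u0; rewrite uu -/v -hE => /le_trans; apply.
  rewrite ler_pdivrMr//; have := ler_wpM2l (enorm_ge0 (y - u)) (ltW ny); lra.
have hrho : enorm h < rho by lra.
move: hrho; rewrite !lt_min => /andP[/andP[hr hr'] hG].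
have Uv : U v by apply: r'U; rewrite -hE.
have fv : f v = 0.
  have : (B `&` U) v by [].
  by rewrite BU => -[[]].
have := rP _ hr; rewrite vE fv fu subrr sub0r normrN.
have v1 : enorm v = 1 by exact: enorm_unitv.
(* [u] and [u + h] are unit vectors: the radial part of [h] is quadratic *)
have uh : dot u h = - (enorm h ^+ 2 / 2).
  have : dot v v = 1 by rewrite -sqr_enorm v1 expr1n.
  rewrite -vE sqr_enorm !dotE duu (dotC h u); lra.
have -> : dot (gradient f u) h = dot g v + G * dot u h.
  rewrite -vE [in RHS]dotDr gu add0r /g [in RHS]dotDl dotNl dotZl; ring.
have gv : dot g v = (enorm y)^-1 * dot g y by rewrite dotZr.
have hn := enorm_ge0 h.
have gvE : e * enorm h / 2 <= `|dot g v|.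
  rewrite gv normrM normfV (gtr0_norm yp).
  have vy : enorm h <= 2 * enorm (y - u) / enorm y.
    by have := unitv_dist y0 u0; rewrite uu -/v -hE.
  rewrite mulrC [leRHS]mulrC ler_pdivlMr//.
  apply: le_trans gy; rewrite ler_pdivlMr// in vy.
  by have := ler_wpM2l (ltW e0) vy; lra.
have GE : `|G * dot u h| <= e * enorm h / 16.
  rewrite uh mulrN normrN normrM (ger0_norm (_ : 0 <= _ / 2)) ?divr_ge0 ?sqr_ge0//.
  rewrite ltr_pdivlMr ?mulr_gt0// in hG.
  have := ler_wpM2r hn (ltW hG); have := normr_ge0 G.
  rewrite expr2; have := mulr_ge0 hn hn; lra.
have := ler_normB (dot g v + G * dot u h) (G * dot u h).
rewrite addrK => tri fh.
(* otherwise the linear term [e |h| / 2] exceeds both errors, at most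
   [e |h| / 8] and [e |h| / 16] *)
have h0 : enorm h = 0.
  apply/eqP; rewrite eq_le hn andbT -(pmulr_rle0 _ e0); lra.
have vu : v = u by apply/eqP; rewrite -subr_eq0; apply/eqP/enorm_eq0; rewrite -hE.
have yE : y = enorm y *: u by rewrite -vu unitvK.
move: gy; rewrite yE dotZr gu mulr0 normr0 -yE => H.
have : 0 < e * enorm (y - u) by rewrite mulr_gt0// enorm_gt0// subr_eq0.
by rewrite ltNge H.
Qed.

(** The two halves of the double cone around [+g] and [-g] avoid the boundary
    of [C].  One of them contains interior points of [C], hence lies in [C]; if
    [C] had a point on the other side of the hyperplane, the other half would
    lie in [C] too and [m] would be interior by convexity. *)
Lemma tangent_halfspace m :
  C1_sphere_hypersurface (sphere_boundary (C `&` sphere)) ->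
  C^° !=set0 -> m != 0 -> C m -> ~ C^° m ->
  exists nu, [/\ dot nu m = 0, (forall y, C y -> 0 <= dot nu y),
    (exists2 a, C^° a & 0 < dot nu a) &
    forall e, 0 < e -> exists2 r, 0 < r & forall t y, 0 < t -> ~ C y ->
      enorm (y - t *: m) < r * t -> dot nu y <= e * enorm (y - t *: m)].
Proof.
move=> hyp [a0 Ca0] m0 Cm nCm; have mp := enorm_gt0 m0.
pose u := unitv m.
have u1 : enorm u = 1 by exact: enorm_unitv.
have u0 : u != 0.
  by apply/eqP => u0; move: u1; rewrite u0 enorm0 => /esym/eqP; rewrite oner_eq0.
have Cu : C u by apply: scaleC => //; rewrite invr_gt0.
have nCu : ~ C^° u by move=> Iu; apply: nCm; rewrite -(unitvK m0);
  exact: interior_scale.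
have [g0 [g0n g0u] nobd0] := normal_double_cone hyp u1 Cu nCu.
have [a Ca ga0] : exists2 a, C^° a & dot g0 a != 0.
  have [ga|ga] := eqVneq (dot g0 a0) 0; last by exists a0.
  have [s s0 Cs] := interior_perturb g0 Ca0.
  exists (a0 + s *: g0); first exact: Cs.
  rewrite dotDr dotZr ga add0r; exact: lt0r_neq0 (mulr_gt0 s0 (dot_gt0 g0n)).
have [g [gu ga nobd]] : exists g, [/\ dot g u = 0, 0 < dot g a & forall e, 0 < e ->
    exists2 r, 0 < r & forall y, y != u -> enorm (y - u) < r ->
     e * enorm (y - u) <= `|dot g y| -> C y -> C^° y].
  have [ga|ga|ga] := ltgtP 0 (dot g0 a); first by exists g0.
    exists (- g0); split; rewrite ?dotNl ?g0u ?oppr0 ?oppr_gt0// => e e0.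
    have [r r0 rP] := nobd0 _ e0; exists r => // y.
    by rewrite dotNl normrN; exact: rP.
  by move: ga0; rewrite -ga eqxx.
have plus := no_boundary_cone u0 gu Cu Ca ga nobd.
have gm : dot g m = 0 by rewrite -(unitvK m0) dotZr gu mulr0.
exists g; split; [exact: gm| |by exists a|]; last first.
  move=> e e0; have [r r0 rP] := plus _ e0.
  exists (r * enorm m); first exact: mulr_gt0.
  move=> t y t0 nCy ytm; rewrite leNgt; apply: contra_notN nCy => lt_gy.
  have c0 : 0 < (t * enorm m)^-1 by rewrite invr_gt0 mulr_gt0.
  have E : (t * enorm m)^-1 *: y - u = (t * enorm m)^-1 *: (y - t *: m).
    by apply/rowP => i; rewrite !mxE; field; rewrite !gt_eqF.
  have : C ((t * enorm m)^-1 *: y).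
    apply: rP; rewrite E enormZ gtr0_norm//.
      by rewrite ltr_pdivrMl ?mulr_gt0// mulrC mulrA (mulrAC r).
    by rewrite dotZr mulrCA ler_pM2l// ltW.
  move=> /(@scaleC (t * enorm m)); rewrite scalerA divff ?scale1r ?gt_eqF ?mulr_gt0//.
  by apply.
move=> y Cy; rewrite leNgt; apply/negP => gy.
(* interior points of [C] are needed on the negative side too *)
have [b Cb gb] : exists2 b, C^° b & dot g b < 0.
  pose s := - dot g y / (2 * dot g a).
  have s0 : 0 < s by rewrite divr_gt0 ?oppr_gt0// mulr_gt0.
  exists (s *: a + y); first by apply: interior_add => //; exact: interior_scale.
  rewrite !dotE /s; have -> : - dot g y / (2 * dot g a) * dot g a = - dot g y / 2.
    by field; rewrite gt_eqF.
  lra.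
have minus : forall e, 0 < e -> exists2 r, 0 < r & forall y, enorm (y - u) < r ->
     e * enorm (y - u) <= dot (- g) y -> C y.
  apply: (no_boundary_cone u0 _ Cu Cb); rewrite ?dotNl ?gu ?oppr0 ?oppr_gt0//.
  move=> e e0; have [r r0 rP] := nobd _ e0; exists r => // z.
  by rewrite dotNl normrN; exact: rP.
have ap : 0 < enorm a.
  apply: enorm_gt0; apply: contraTneq ga => ->.
  by rewrite -(scale0r (0 : 'rV[R]_d)) dotZr mul0r ltxx.
(* [u - s a] is in [C], so that [u = (u - s a) + s a] is interior *)
have [r r0 rP] := minus (dot g a / enorm a) (divr_gt0 ga ap).
apply: nCu; pose s := r / (2 * enorm a).
have s0 : 0 < s by rewrite divr_gt0// mulr_gt0.
rewrite -(subrK (s *: a) u) addrC; apply: interior_add; first exact: interior_scale.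
apply: rP; rewrite addrAC subrr add0r enormN enormZ gtr0_norm//.
  rewrite (_ : s * enorm a = r / 2); first lra.
  by rewrite /s; field; rewrite gt_eqF.
rewrite dotNl dotDr gu dotNr dotZr add0r opprK mulrCA divfK ?gt_eqF//.
Qed.

End ClosedCone.
End Cones.

(** * Integrals over the lattice *)

Section LatticeIntegral.
Local Open Scope ereal_scope.
Context {R : realType} {d : nat}.
Implicit Types (z : lattice d).

Lemma lattice_measurable (A : set (lattice d)) : measurable A.
Proof. by []. Qed.

Lemma lattice_measurable_fun disp (T : sigmaRingType disp) (A : set (lattice d))
  (f : lattice d -> T) : measurable_fun A f.
Proof. by move=> mA B mB; exact: lattice_measurable. Qed.

(** The lattice is the countable disjoint union of the level sets of [pickle],
    each of which is empty or a point. *)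
Lemma integral_lattice (nu : {measure set (lattice d) -> \bar R})
    (f : lattice d -> \bar R) : (forall z, 0 <= f z) ->
  \int[nu]_z f z = \esum_(z in [set: lattice d]) f z * nu [set z].
Proof.
move=> f0; pose F k := [set z : lattice d | pickle z = k].
have coverF : \bigcup_k F k = setT by apply/seteqP; split=> // z _; exists (pickle z).
have tF : trivIset setT F by move=> i j _ _ [z [/= <- <-]].
have point z : \int[nu]_(x in [set z]) f x = f z * nu [set z].
  rewrite (eq_integral (cst (f z))); first by rewrite integral_cst.
  by move=> x /[!inE] ->.
rewrite -coverF ge0_integral_bigcup//.
rewrite esum_bigcupT//; last by move=> z; rewrite mule_ge0.
rewrite nneseries_esumT; last by move=> k; exact: integral_ge0.
apply: eq_esum => k _.
have [[z Fz]|nF] := pselect (exists z, F k z).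
  have -> : F k = [set z].
    apply/seteqP; split=> [x Fx|x ->//].
    by apply: (pcan_inj pickleK_inv); rewrite Fx Fz.
  by rewrite point esum_set1// mule_ge0.
have -> : F k = set0 by apply/seteqP; split=> // z Fz; apply: nF; exists z.
by rewrite integral_set0 esum_set0.
Qed.

End LatticeIntegral.

(** * The killed one-step operator and the law of the exit time *)

Section KilledStep.
Local Open Scope ereal_scope.
Context {R : realType} {d : nat}.
Variables (mu : probability (lattice d) R) (E : set (lattice d)).
Implicit Types (x y z : lattice d) (f g : lattice d -> \bar R).

(** Transition operator of the walk killed outside [E]; the mass which leaves
    [E] is lost.  Values are extended reals so that no integrability question
    arises for nonnegative functions. *)
Definition killed_step f y : \bar R := \int[mu]_z (f \_ E) (y + z)%R.

Definition survival n : lattice d -> \bar R := iter n killed_step (cst 1).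

Lemma patch_ge0 f : (forall y, E y -> 0 <= f y) -> forall y, 0 <= (f \_ E) y.
Proof. by move=> f0 y; rewrite patchE; case: ifPn => // /set_mem/f0. Qed.

Lemma killed_step_ge0 f : (forall y, E y -> 0 <= f y) ->
  forall y, 0 <= killed_step f y.
Proof. by move=> f0 y; apply: integral_ge0 => z _; exact: patch_ge0. Qed.

Lemma iter_killed_step_ge0 n f : (forall y, 0 <= f y) ->
  forall y, 0 <= iter n killed_step f y.
Proof. by move=> f0; elim: n => [//|n IH] y /=; apply: killed_step_ge0. Qed.

Lemma survival_ge0 n y : 0 <= survival n y.
Proof. by apply: iter_killed_step_ge0 => z; rewrite lee_fin ler01. Qed.

Lemma killed_stepE f y : (forall y, E y -> 0 <= f y) ->
  killed_step f y = \esum_(z in [set: lattice d]) (f \_ E) z * mu [set (z - y)%R].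
Proof.
move=> f0; rewrite /killed_step integral_lattice; last by move=> z; exact: patch_ge0.
rewrite (reindex_esum setT setT (fun z => (z - y)%R)).
  by apply: eq_esum => z _; rewrite addrC subrK.
split=> // [z z' _ _|z _]; first exact: addIr.
by exists (z + y)%R => //; rewrite addrK.
Qed.

Lemma le_killed_step f g : (forall y, E y -> 0 <= f y) ->
  (forall y, E y -> f y <= g y) -> forall y, killed_step f y <= killed_step g y.
Proof.
move=> f0 fg y; apply: ge0_le_integral => //.
- by move=> z _; exact: patch_ge0.
- by move=> z _; rewrite !patchE; case: ifPn => // /set_mem/fg.
Qed.

Lemma killed_stepD f g : (forall y, E y -> 0 <= f y) -> (forall y, E y -> 0 <= g y) ->
  forall y, killed_step (f \+ g) y = killed_step f y + killed_step g y.
Proof.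
move=> f0 g0 y; rewrite /killed_step -ge0_integralD//.
- by apply: eq_integral => z _; rewrite !patchE; case: ifPn => //; rewrite adde0.
- by move=> z _; exact: patch_ge0.
- by move=> z _; exact: patch_ge0.
Qed.

Lemma killed_stepZ (c : R) f : (0 <= c)%R -> (forall y, E y -> 0 <= f y) ->
  forall y, killed_step (fun y => c%:E * f y) y = c%:E * killed_step f y.
Proof.
move=> c0 f0 y; rewrite /killed_step -ge0_integralZl_EFin//.
- by apply: eq_integral => z _; rewrite !patchE; case: ifPn => //; rewrite mule0.
- by move=> z _; exact: patch_ge0.
Qed.

End KilledStep.

Section WalkSurvival.
Local Open Scope ereal_scope.
Context {R : realType} {d : nat} {disp : measure_display} {Omega : measurableType disp}.
Variables (mu : probability (lattice d) R) (P : lattice d -> probability Omega R)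
  (X : nat -> {mfun Omega >-> lattice d}).
Hypothesis walkX : random_walk mu P X.
Implicit Types (x y z : lattice d) (p : nat -> lattice d).

Lemma measurable_preim n (A : set (lattice d)) : measurable (X n @^-1` A).
Proof. by rewrite -[X in measurable X]setTI; exact: measurable_funP. Qed.

Lemma measure_by_value (Q : probability Omega R) (A : set Omega) n : measurable A ->
  Q A = \esum_(z in [set: lattice d]) Q (A `&` X n @^-1` [set z]).
Proof.
move=> mA.
have := @integral_lattice R d (pushforward (mrestr Q mA) (X n)) (cst 1).
move=> /(_ (measurable_funPT (X n))); rewrite integral_cst// mul1e => E;
  transitivity (pushforward (mrestr Q mA) (X n) setT).
  by rewrite /pushforward /mrestr preimage_setT setTI.
rewrite E; last by move=> z; rewrite lee_fin ler01.
by apply: eq_esum => z _; rewrite mul1e /pushforward /mrestr setIC.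
Qed.

Variable E : set (lattice d).

Definition cylinder j p := [set w | forall k, (k <= j)%N -> X k w = p k].
Definition stays j r := [set w | forall k, (j < k <= j + r)%N -> E (X k w)].

Lemma measurable_cylinder j p : measurable (cylinder j p).
Proof.
rewrite (_ : cylinder j p = \bigcap_(k in [set k | (k <= j)%N]) X k @^-1` [set p k])//.
by apply: bigcap_measurableType => k _; exact: measurable_preim.
Qed.

Lemma measurable_stays j r : measurable (stays j r).
Proof.
rewrite (_ : stays j r = \bigcap_(k in [set k | (j < k <= j + r)%N]) X k @^-1` E)//.
by apply: bigcap_measurableType => k _; exact: measurable_preim.
Qed.

(** The law of the walk is only given on cylinders fixing a whole past, so the
    past is kept fixed and the induction is on the number of future steps: the
    first of them is decomposed according to its value, which is then added to
    the past. *)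
Lemma cylinder_stays x r j p :
  P x (cylinder j p `&` stays j r) = P x (cylinder j p) * survival mu E r (p j).
Proof.
elim: r j p => [|r IH] j p.
  rewrite mule1; congr (P x _); apply/seteqP; split=> [w []//|w pw]; split=> // k.
  by rewrite addn0 => /andP[/leq_trans H /H]; rewrite ltnn.
have fin : P x (cylinder j p) \is a fin_num.
  exact: fin_num_measure (measurable_cylinder j p).
have S0 y : E y -> 0 <= survival mu E r y by move=> _; exact: survival_ge0.
rewrite (@measure_by_value _ _ j.+1); last first.
  by apply: measurableI; [exact: measurable_cylinder|exact: measurable_stays].
rewrite -[P x (cylinder j p)]fineK// [survival mu E r.+1 _]/=.
rewrite -killed_stepZ ?fine_ge0// killed_stepE; last first.
  by move=> y Ey; apply: mule_ge0; rewrite ?lee_fin ?fine_ge0// S0.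
apply: eq_esum => z _; rewrite patchE; case: ifPn => [/set_mem Ez|/negP nEz];
  last first.
  rewrite mul0e (_ : _ `&` _ = set0) ?measure0//.
  apply/seteqP; split=> // w [[_ sw] /= Xz]; apply: nEz; apply/mem_set; rewrite -Xz;
    apply: sw.
  by rewrite ltnSn addnS ltnS leq_addr.
(* the past [p] extended by the value [z] at time [j + 1] *)
pose p' k := if (k <= j)%N then p k else z.
have p'z : p' j.+1 = z by rewrite /p' ltnn.
have cyl' : cylinder j p' = cylinder j p.
  by apply/seteqP; split=> w pw k kj; rewrite pw// /p' kj.
have stepE : P x (cylinder j p) * mu [set (z - p j)%R] = P x (cylinder j.+1 p').
  by rewrite -cyl' (walkX x).2 p'z /p' leqnn.
rewrite fineK// muleAC stepE -[in RHS]p'z -IH; congr (P x _); apply/seteqP; split => w.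
  move=> [[pw sw] Xz]; split => k.
    by rewrite leq_eqVlt ltnS => /orP[/eqP->|kj]; rewrite ?Xz ?p'z// pw// /p' kj.
  by rewrite addSnnS => /andP[kj kr]; apply: sw; rewrite kr andbT ltnW.
move=> [pw sw]; split; last by rewrite /= pw// p'z.
split=> k.
  by move=> kj; rewrite pw ?leqW// /p' kj.
move=> /andP[]; rewrite leq_eqVlt => /orP[/eqP<- _|jk kr]; first by rewrite pw// p'z.
by apply: sw; rewrite jk addSnnS.
Qed.

Lemma survivalE x n : E x ->
  P x [set w | forall k, (k <= n)%N -> E (X k w)] = survival mu E n x.
Proof.
move=> Ex; pose A := [set w | forall k, (k <= n)%N -> E (X k w)].
have P0 := (walkX x).1; pose p (k : nat) := x.
have cyl0 : cylinder 0 p = [set w | X 0 w = x].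
  by apply/seteqP; split=> [w /(_ 0%N) /= -> //|w Xx k]; rewrite leqn0 => /eqP->.
have := cylinder_stays x n 0 p; rewrite cyl0 P0 mul1e => <-.
have mS := measurable_stays 0 n.
have mX0 : measurable [set w | X 0 w = x] by rewrite -cyl0; exact: measurable_cylinder.
have -> : [set w | forall k, (k <= n)%N -> E (X k w)] =
    X 0 @^-1` E `&` stays 0 n.
  apply/seteqP; split=> [w Aw|w [E0 sw] [//|k] kn].
    by split=> [|k /andP[_]]; [exact: Aw|rewrite add0n => /Aw].
  by apply: sw; rewrite add0n.
have mE0 : measurable (X 0 @^-1` E) by exact: measurable_preim.
apply/eqP; rewrite eq_le; apply/andP; split; last first.
  by apply: le_measure; rewrite ?inE; [exact: measurableI|exact: measurableI|
    move=> w [/= Xx sw]; split=> //; rewrite /preimage /= Xx].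
(* the two events differ inside the null event that the walk starts elsewhere *)
have nullc : P x (~` [set w | X 0 w = x]) = 0 by rewrite probability_setC// P0 subee.
rewrite -[leRHS]adde0 -nullc.
apply: le_trans (measureU2 _ _ _); last 2 first.
- exact: measurableI.
- exact: measurableC.
apply: le_measure; rewrite ?inE; [exact: measurableI| |].
- by apply: measurableU; [exact: measurableI|exact: measurableC].
- by move=> w [_ sw]; have [Xx|nXx] := pselect (X 0 w = x); [left|right].
Qed.

End WalkSurvival.

Section ExitTime.
Local Open Scope ereal_scope.
Context {R : realType} {d : nat} {disp : measure_display} {Omega : measurableType disp}.
Variables (mu : probability (lattice d) R) (P : lattice d -> probability Omega R)
  (X : nat -> {mfun Omega >-> lattice d}) (C : set 'rV[R]_d).
Hypothesis walkX : random_walk mu P X.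

Lemma measurable_exit_time : measurable_fun [set: Omega] (exit_time C X : _ -> \bar R).
Proof.
pose u (n : nat) (y : lattice d) : \bar R :=
  if `[< C (real_vec y) >] then +oo else (n%:R)%:E.
rewrite (_ : exit_time C X = fun w => einfs (fun n => u n (X n w)) 0%N).
  apply: measurable_fun_einfs => n.
  apply: (measurableT_comp (f := u n)); first exact: lattice_measurable_fun.
  exact: measurable_funPT.
apply/funext => w; apply/eqP; rewrite eq_le; apply/andP; split.
  apply: le_ereal_inf_tmp => _ [n _ <-]; rewrite /u.
  case: asboolP => [_|nC]; first exact: leey.
  by apply: ereal_inf_lbound; exists n.
apply: le_ereal_inf_tmp => _ [n nC <-]; apply: ereal_inf_lbound.
by exists n => //; rewrite /u; case: asboolP.
Qed.

Lemma exit_time_ge0 w : 0 <= exit_time C X w.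
Proof. by apply: le_ereal_inf_tmp => _ [n _ <-]; rewrite lee_fin. Qed.

(** The exit time dominates the number of [k < n] with [tau > k]. *)
Lemma sum_survival_le_exit x n : lattice_points C x ->
  \sum_(k < n) survival mu (lattice_points C) k x <= \int[P x]_w exit_time C X w.
Proof.
move=> Cx; pose S k := [set w | forall i, (i <= k)%N -> lattice_points C (X i w)].
have mS k : measurable (S k).
  rewrite (_ : S k = \bigcap_(i in [set i | (i <= k)%N]) X i @^-1` (lattice_points C))//.
  by apply: bigcap_measurableType => i _; exact: measurable_preim.
rewrite (eq_bigr (fun k : 'I_n => \int[P x]_w (\1_(S k) w)%:E)); last first.
  by move=> k _; rewrite integral_indic// setIT; apply/esym/(survivalE walkX).
rewrite -ge0_integral_sum//; last first.
  by move=> k; apply/measurable_EFinP; exact: measurable_indic.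
apply: ge0_le_integral => //.
- by move=> w _; apply: sume_ge0 => k _; rewrite lee_fin.
- apply: emeasurable_sum => k; apply/measurable_EFinP; exact: measurable_indic.
- exact: measurable_exit_time.
move=> w _; apply: le_ereal_inf_tmp => _ [m nC <-].
rewrite sumEFin lee_fin.
apply: (@le_trans _ _ (\sum_(k < n) (k < m)%N%:R)%R).
  apply: ler_sum => k _; rewrite indicE ler_nat.
  case: (ltnP k m) => [_|mk]; first by case: (_ \in _).
  by case: (boolP (_ \in _)) => // /set_mem/(_ m mk).
rewrite -natr_sum ler_nat.
apply: (@leq_trans (minn n m)); last exact: geq_minr.
elim: n {Cx} => [|n IH]; first by rewrite big_ord0.
by rewrite big_ord_recr /=; apply: leq_trans (leq_add IH (leqnn _)) _;
  case: ltnP => ?; lia.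
Qed.

End ExitTime.

(** * Moments of a step *)

Section Moments.
Context {R : realType} {d : nat}.
Variables (mu : probability (lattice d) R).
Implicit Types (x y z : lattice d) (l nu : 'rV[R]_d) (f g : lattice d -> R).

Local Notation integrable f := (mu.-integrable setT (EFin \o f)).
Local Notation m := (mean mu).
Local Notation xi z := (real_vec z - m).

Lemma real_vecD x y : real_vec (x + y) = real_vec x + real_vec y :> 'rV[R]_d.
Proof. by apply/rowP => i; rewrite !mxE intrD. Qed.

Lemma lattice_integrable f g : (forall z, `|f z| <= g z) -> integrable g -> integrable f.
Proof.
move=> fg; apply: le_integrable => //.
by move=> z _ /=; rewrite lee_fin (le_trans (fg z)) ?ler_norm.
Qed.

Lemma integrable_const (c : R) : integrable (fun _ => c).
Proof. exact: finite_measure_integrable_cst. Qed.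

Lemma integrable_add f g : integrable f -> integrable g -> integrable (fun z => f z + g z).
Proof. by move=> f_int g_int; exact: (integrableD measurableT f_int g_int). Qed.

Lemma integrable_scale (c : R) f : integrable f -> integrable (fun z => c * f z).
Proof. by move=> f_int; exact: (integrableZl measurableT c f_int). Qed.

Lemma integrable_bigsum (I : Type) (s : seq I) (F : I -> lattice d -> R) :
  (forall i, integrable (F i)) -> integrable (fun z => \sum_(i <- s) F i z).
Proof.
move=> F_int; elim: s => [|i s IH].
  by under eq_fun do rewrite big_nil; exact: integrable_const.
by under eq_fun do rewrite big_cons; exact: integrable_add.
Qed.

(** This is how exponential moments give the fourth moment. *)
Lemma quartic_le_expR (e t : R) : 0 < e ->
  t ^+ 4 <= 24 / e ^+ 4 * (expR (e * t) + expR (- (e * t))).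
Proof.
move=> e0; have e4 : 0 < e ^+ 4 by rewrite exprn_gt0.
have K0 : 0 <= 24 / e ^+ 4 by rewrite divr_ge0// ltW.
have pos s : 0 <= s -> s ^+ 4 <= 24 / e ^+ 4 * expR (e * s).
  move=> s0; rewrite mulrAC ler_pdivlMr// -exprMn [s * e]mulrC -ler_pdivrMl//.
  by have := expR_ge1Dxn 3 (mulr_ge0 (ltW e0) s0); apply: le_trans;
    rewrite (_ : 4`! = 24)%N// [leLHS]mulrC lerDr.
have [t0|t0] := leP 0 t.
  by apply: le_trans (pos _ t0) _; rewrite ler_wpM2l// lerDl expR_ge0.
have := pos (- t); rewrite oppr_ge0 => /(_ (ltW t0)).
rewrite mulrN (_ : (- t) ^+ 4 = t ^+ 4); last by ring.
by move=> /le_trans; apply; rewrite ler_wpM2l// lerDr expR_ge0.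
Qed.

Lemma integrable_exp (a : 'rV[R]_d) : (laplace mu a < +oo)%E ->
  integrable (fun z => expR (dot a (real_vec z))).
Proof.
move=> fin; apply/integrableP; split; first by [].
rewrite integral_lattice; last by move=> z; exact: abse_ge0.
rewrite (eq_esum (b := fun z => ((expR (dot a (real_vec z)))%:E * mu [set z])%E))//.
by move=> z _; rewrite /= ger0_norm// expR_ge0.
Qed.

Lemma integrable_quartic : laplace_finite_near_sublevel mu ->
  integrable (fun z => dot (real_vec z) (real_vec z) ^+ 2).
Proof.
move=> [U [oU subU finU]].
(* the Laplace transform at 0 is the total mass of [mu] *)
have U0 : U 0.
  apply: subU => /=.
  have : (\int[mu]_z cst 1 z = 1)%E by rewrite integral_cst// mul1e;
    exact: probability_setT.
  rewrite integral_lattice; last by move=> z; rewrite lee_fin.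
  move=> E; rewrite /laplace -[leRHS]E; apply: le_esum => z _.
  by rewrite -(scale0r (0 : 'rV[R]_d)) dotZl mul0r expR0.
have /nbhs_enormP[r r0 rU] : nbhs (0 : 'rV[R]_d) U by exact: open_nbhs_nbhs.
pose e := r / 2; have e0 : 0 < e by rewrite divr_gt0.
have dE (i : 'I_d) z s :
    dot (s *: delta_mx ord0 i) (real_vec z) = s * (real_vec z : 'rV[R]_d) ord0 i.
  rewrite dotZl; congr (_ * _);
    rewrite /dot (bigD1 i)//= !mxE !eqxx /= mul1r big1 ?addr0//.
  by move=> j ji; rewrite mxE eqxx /= (negPf ji) mul0r.
have Ue (i : 'I_d) s : `|s| = e -> U (s *: delta_mx ord0 i).
  move=> se; apply: rU; rewrite subr0 enormZ se /enorm /dot (bigD1 i)//= big1.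
    by rewrite !mxE !eqxx /= mulr1 addr0 sqrtr1 mulr1 /e; lra.
  by move=> j ji; rewrite mxE eqxx /= (negPf ji) mul0r.
have intE (i : 'I_d) s : `|s| = e ->
    integrable (fun z => expR (s * (real_vec z : 'rV[R]_d) ord0 i)).
  move=> se; have := integrable_exp (finU _ (Ue i s se)).
  by under eq_fun do rewrite dE.
pose g z := d%:R * \sum_(i < d) 24 / e ^+ 4 *
  (expR (e * (real_vec z : 'rV[R]_d) ord0 i) + expR (- e * (real_vec z : 'rV[R]_d) ord0 i)).
apply: (@lattice_integrable _ g); last first.
  apply: integrable_scale.
  apply: integrable_bigsum => i; apply: integrable_scale; apply: integrable_add;
    apply: intE.
    by rewrite gtr0_norm.
  by rewrite normrN gtr0_norm.
move=> z; rewrite ger0_norm ?sqr_ge0//.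
(* Cauchy-Schwarz reduces the square of the sum of the [z_i ^+ 2] to the sum of
   the [z_i ^+ 4] *)
pose a : 'rV[R]_d := \row_i ((real_vec z : 'rV[R]_d) ord0 i) ^+ 2.
have := dot_sqr_le a (const_mx 1).
have -> : dot a (const_mx 1) = dot (real_vec z) (real_vec z).
  by apply: eq_bigr => i _; rewrite !mxE mulr1 expr2.
have -> : dot (const_mx 1 : 'rV[R]_d) (const_mx 1) = d%:R.
  rewrite /dot -[d in RHS]card_ord -sumr_const; apply: eq_bigr => i _.
  by rewrite mxE mulr1.
move=> /le_trans; apply; rewrite mulrC /g; apply: ler_wpM2l => //.
apply: ler_sum => i _; rewrite mulNr mxE -exprD.
exact: quartic_le_expR.
Qed.

Hypothesis B2 : laplace_finite_near_sublevel mu.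

Lemma integrable_step4 : integrable (fun z => dot (xi z) (xi z) ^+ 2).
Proof.
apply: (@lattice_integrable _
  (fun z => 8 * dot (real_vec z) (real_vec z) ^+ 2 + 8 * dot m m ^+ 2)).
  move=> z; rewrite ger0_norm ?sqr_ge0//.
  apply: le_trans (_ : (2 * dot (real_vec z) (real_vec z) + 2 * dot m m) ^+ 2 <= _).
    by apply: lerXn2r;
      rewrite ?nnegrE ?dot_ge0 ?addr_ge0 ?mulr_ge0 ?dot_ge0// dot_sub_sqr_le.
  have := sqr_ge0 (dot (real_vec z) (real_vec z) - dot m m).
  rewrite !expr2; lra.
apply: integrable_add; last exact: integrable_const.
by apply: integrable_scale; exact: integrable_quartic.
Qed.

Lemma integrable_step f (c : R) :
  (forall z, `|f z| <= c * (1 + dot (xi z) (xi z) ^+ 2)) -> integrable f.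
Proof.
move=> /lattice_integrable; apply; apply: integrable_scale; apply: integrable_add.
  exact: integrable_const.
exact: integrable_step4.
Qed.

Lemma integrable_step2 : integrable (fun z => dot (xi z) (xi z)).
Proof.
apply: (@integrable_step _ 1) => z; rewrite ger0_norm ?dot_ge0// mul1r.
by have := sqr_ge0 (dot (xi z) (xi z) - 1); rewrite !expr2; have := dot_ge0 (xi z); lra.
Qed.

Lemma integrable_step_dir nu : integrable (fun z => dot nu (xi z) ^+ 2).
Proof.
apply: (@lattice_integrable _ (fun z => dot nu nu * dot (xi z) (xi z))).
  by move=> z; rewrite ger0_norm ?sqr_ge0// dot_sqr_le.
by apply: integrable_scale; exact: integrable_step2.
Qed.

Lemma integrable_step_lin l : integrable (fun z => dot l (xi z)).
Proof.
apply: (@lattice_integrable _ (fun z => 1 + dot l (xi z) ^+ 2)).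
  move=> z; rewrite -real_normK ?num_real//.
  by have := sqr_ge0 (`|dot l (xi z)| - 1); rewrite !expr2;
    have := normr_ge0 (dot l (xi z)); lra.
by apply: integrable_add; [exact: integrable_const|exact: integrable_step_dir].
Qed.

Local Notation EE f := (\int[mu]_z f z)%R.

Lemma expect_add f g : integrable f -> integrable g ->
  EE (fun z => f z + g z) = EE f + EE g.
Proof. by move=> ? ?; rewrite RintegralD. Qed.

Lemma expect_scale (c : R) f : integrable f -> EE (fun z => c * f z) = c * EE f.
Proof. by move=> ?; rewrite RintegralZl. Qed.

Lemma expect_const (c : R) : EE (fun _ => c) = c.
Proof.
rewrite Rintegral_cst//; transitivity (c * fine 1%E); last by rewrite mulr1.
by congr (_ * fine _); exact: probability_setT.
Qed.

Lemma expect_step_lin l : EE (fun z => dot l (xi z)) = 0.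
Proof.
have intz (i : 'I_d) : integrable (fun z => ((z : 'rV[int]_d) ord0 i)%:~R : R).
  have -> : (fun z : lattice d => ((z : 'rV[int]_d) ord0 i)%:~R : R) =
      (fun z => dot (delta_mx ord0 i) (xi z) + m ord0 i).
    apply/funext => z;
      rewrite /dot (bigD1 i)//= !mxE !eqxx /= mul1r big1 ?addr0 ?subrK//.
    by move=> j ji; rewrite mxE eqxx /= (negPf ji) mul0r.
  by apply: integrable_add; [exact: integrable_step_lin|exact: integrable_const].
have int1 i : integrable (fun z =>
    l ord0 i * (((z : 'rV[int]_d) ord0 i)%:~R - m ord0 i) : R).
  apply: integrable_scale; apply: integrable_add; [exact: intz|exact: integrable_const].
have H (s : seq 'I_d) :
   integrable (fun z => \sum_(i <- s) l ord0 i *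
      (((z : 'rV[int]_d) ord0 i)%:~R - m ord0 i) : R) /\
   EE (fun z => \sum_(i <- s) l ord0 i * (((z : 'rV[int]_d) ord0 i)%:~R - m ord0 i) : R) = 0.
  elim: s => [|i s [IH1 IH2]].
    under eq_fun do rewrite big_nil.
    by split; [exact: integrable_const|exact: expect_const].
  under eq_fun do rewrite big_cons; split; first exact: integrable_add.
  rewrite expect_add// IH2 addr0 expect_scale; last first.
    by apply: integrable_add; [exact: intz|exact: integrable_const].
  rewrite expect_add//; last exact: integrable_const.
  by rewrite expect_const mxE subrr mulr0.
rewrite -[RHS](H (index_enum 'I_d)).2; apply: eq_Rintegral => z _.
by apply: eq_bigr => i _; rewrite !mxE.
Qed.

(** The functions of the position after one step are compared with functions of
    the centred step of this form, whose expectation involves three moments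
    only. *)
Definition step_form (A : R) l nu (b c : R) z : R :=
  A + dot l (xi z) + dot nu (xi z) ^+ 2 - b * dot (xi z) (xi z)
    - c * dot (xi z) (xi z) ^+ 2.

Lemma step_form_integrable A l nu b c : integrable (step_form A l nu b c).
Proof.
have -> : step_form A l nu b c = fun z => A + (dot l (xi z) + (dot nu (xi z) ^+ 2 +
    ((- b) * dot (xi z) (xi z) + (- c) * dot (xi z) (xi z) ^+ 2))).
  by apply/funext => z; rewrite /step_form; ring.
apply: integrable_add; first exact: integrable_const.
apply: integrable_add; first exact: integrable_step_lin.
apply: integrable_add; first exact: integrable_step_dir.
apply: integrable_add; apply: integrable_scale; first exact: integrable_step2.
exact: integrable_step4.
Qed.

Lemma expect_step_form A l nu b c : EE (step_form A l nu b c) =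
  A + EE (fun z => dot nu (xi z) ^+ 2) - b * EE (fun z => dot (xi z) (xi z))
   - c * EE (fun z => dot (xi z) (xi z) ^+ 2).
Proof.
have -> : step_form A l nu b c = fun z => A + (dot l (xi z) + (dot nu (xi z) ^+ 2 +
    ((- b) * dot (xi z) (xi z) + (- c) * dot (xi z) (xi z) ^+ 2))).
  by apply/funext => z; rewrite /step_form; ring.
have i4 := integrable_step4; have i2 := integrable_step2.
have inu := integrable_step_dir nu; have il := integrable_step_lin l.
have j4 := integrable_scale (- c) i4; have j2 := integrable_scale (- b) i2.
have k1 := integrable_add j2 j4; have k2 := integrable_add inu k1.
have k3 := integrable_add il k2.
rewrite expect_add//; last exact: integrable_const.
rewrite expect_const expect_add// expect_step_lin expect_add// expect_add//.
by rewrite !expect_scale//; ring.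
Qed.

End Moments.

(** * Subsolutions for the killed walk *)

Section Subsolutions.
Context {R : realType} {d : nat}.
Variables (mu : probability (lattice d) R) (E : set (lattice d)).
Hypothesis B2 : laplace_finite_near_sublevel mu.
Implicit Types (x y z : lattice d) (nu T : 'rV[R]_d) (N n s : nat).

Local Notation m := (mean mu).
Local Notation xi z := (real_vec z - m).
Definition moment2 : R := \int[mu]_z dot (xi z) (xi z).
Definition moment4 : R := \int[mu]_z dot (xi z) (xi z) ^+ 2.
Definition variance_along nu : R := \int[mu]_z dot nu (xi z) ^+ 2.

Lemma moment2_ge0 : 0 <= moment2.
Proof. by apply: Rintegral_ge0 => z _; exact: dot_ge0. Qed.

Lemma moment4_ge0 : 0 <= moment4.
Proof. by apply: Rintegral_ge0 => z _; exact: sqr_ge0. Qed.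

Lemma variance_along_ge0 nu : 0 <= variance_along nu.
Proof. by apply: Rintegral_ge0 => z _; exact: sqr_ge0. Qed.

(** The killed operator sees the step form only inside [E]; outside, a
    nonpositive form can be discarded. *)
Lemma killed_step_ge_form (f : lattice d -> \bar R) y A l nu b c :
  (forall y, E y -> (0 <= f y)%E) ->
  (forall z, E (y + z) -> ((step_form mu A l nu b c z)%:E <= f (y + z)%R)%E) ->
  (forall z, ~ E (y + z) -> step_form mu A l nu b c z <= 0) ->
  ((A + variance_along nu - b * moment2 - c * moment4)%:E <= killed_step mu E f y)%E.
Proof.
move=> f0 inE_ge outE_le; set psi := step_form mu A l nu b c in inE_ge outE_le *.
have psi_int : mu.-integrable setT (EFin \o psi) by exact: step_form_integrable.
rewrite -[X in (X%:E <= _)%E](expect_step_form B2 A l nu b c) -/psi.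
have -> : ((\int[mu]_z psi z)%:E = \int[mu]_z (psi z)%:E)%E.
  by rewrite /Rintegral fineK//; exact: integrable_fin_num.
rewrite integralE; apply: (@le_trans _ _ (\int[mu]_z ((EFin \o psi)^\+ z))%E).
  rewrite leeBlDr; last exact: integrable_neg_fin_num.
  by rewrite leeDl// integral_ge0.
apply: ge0_le_integral => //.
move=> z _; rewrite funeposE patchE; case: ifPn => [/set_mem Ez|/negP nEz] /=.
  by rewrite ge_max inE_ge//= f0.
by rewrite ge_max lexx andbT lee_fin outE_le// => Ez; apply: nEz; exact: mem_set.
Qed.

(** The step hypothesis quantifies over all [g] above [G N.+1] rather than
    speaking of the positive part of [G N.+1], so that it applies directly to
    the iterates. *)
Lemma subsolution_le (f : lattice d -> \bar R) (G : nat -> lattice d -> R) s :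
  (forall y, (0 <= f y)%E) ->
  (forall N y, (s <= N)%N -> E y -> ((G N y)%:E <= f y)%E) ->
  (forall N y (g : lattice d -> \bar R), (s <= N)%N -> E y ->
    (forall y', E y' -> (0 <= g y')%E) ->
    (forall y', E y' -> ((G N.+1 y')%:E <= g y')%E) ->
    ((G N y)%:E <= killed_step mu E g y)%E) ->
  forall n N y, (s <= N)%N -> E y -> ((G N y)%:E <= iter n (killed_step mu E) f y)%E.
Proof.
move=> f0 Gf step; elim=> [|n IH] N y sN Ey /=; first exact: Gf.
apply: step => // y' Ey'; first exact: iter_killed_step_ge0.
by apply: IH => //; exact: leq_trans sN (leqnSn N).
Qed.

Definition fluct N y : 'rV[R]_d := real_vec y - N%:R *: m.

Lemma fluctS N y z : fluct N.+1 (y + z) = fluct N y + xi z.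
Proof.
rewrite /fluct real_vecD; apply/rowP => i; rewrite !mxE -[N.+1]addn1 natrD; ring.
Qed.

(** The term in [1 / N] compensates the growth of the mean square of the
    fluctuation along one step. *)
Definition interior_profile (rho : R) N y : R :=
  1 - (dot (fluct N y) (fluct N y) / N%:R ^+ 2 + moment2 / N%:R) / rho.

Lemma interior_profile_step (rho : R) : 0 < rho ->
  (forall N y, (0 < N)%N -> ~ E y -> rho * N%:R ^+ 2 <= dot (fluct N y) (fluct N y)) ->
  forall N y (g : lattice d -> \bar R), (0 < N)%N -> E y ->
    (forall y', E y' -> (0 <= g y')%E) ->
    (forall y', E y' -> ((interior_profile rho N.+1 y')%:E <= g y')%E) ->
    ((interior_profile rho N y)%:E <= killed_step mu E g y)%E.
Proof.
move=> rho0 out N y g N0 Ey g0 Gg.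
(* [T] is kept opaque: rewriting must not expand it as a difference *)
have [T TE] : exists T, T = fluct N y by exists (fluct N y).
pose P := dot T T; pose t : R := N%:R.
have t0 : 0 < t by rewrite ltr0n.
have NE : N.+1%:R = t + 1 :> R by rewrite -natr1.
pose k := ((t + 1) ^+ 2 * rho)^-1.
have t1 : 0 < t + 1 by lra.
have k0 : 0 < k by rewrite invr_gt0 mulr_gt0// exprn_gt0.
pose A := 1 - k * P - moment2 / (t + 1) / rho.
pose psi := step_form mu A (- (2 * k) *: T) 0 k 0.
have psiE z : psi z = interior_profile rho N.+1 (y + z).
  rewrite /psi /step_form /interior_profile fluctS -TE NE; move: (xi z) => h.
  rewrite -(scale0r (0 : 'rV[R]_d)) !dotE (dotC h T) /A /k /P.
  by field; rewrite !gt_eqF.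
apply: (@le_trans _ _ (A + variance_along 0 - k * moment2 - 0 * moment4)%:E);
  last first.
  apply: (killed_step_ge_form (l := - (2 * k) *: T)) => // z Ez;
    first by rewrite -/psi psiE; exact: Gg.
  rewrite -/psi psiE /interior_profile subr_le0 ler_pdivlMr// mul1r.
  apply: ler_wpDr; first by rewrite divr_ge0 ?moment2_ge0.
  by rewrite ler_pdivlMr ?exprn_gt0 ?ltr0n//; exact: out.
have v0 := variance_along_ge0 0.
rewrite lee_fin mul0r subr0 /interior_profile -TE -/P -/t.
have a0 := moment2_ge0; have P0 : 0 <= P by exact: dot_ge0.
suff H : k * P + moment2 / (t + 1) / rho + k * moment2 <= (P / t ^+ 2 + moment2 / t) / rho.
  by rewrite /A; lra.
have -> : k * P + moment2 / (t + 1) / rho + k * moment2 =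
    (P / (t + 1) ^+ 2 + (moment2 / (t + 1) + moment2 / (t + 1) ^+ 2)) / rho.
  by rewrite /k; field; rewrite !gt_eqF.
rewrite ler_pM2r ?invr_gt0//; apply: lerD.
  apply: ler_wpM2l => //; rewrite lef_pV2 ?posrE ?exprn_gt0//.
  by apply: lerXn2r; rewrite ?nnegrE; lra.
rewrite -mulrDr; apply: ler_wpM2l => //.
rewrite -subr_ge0 (_ : _ - _ = (t * (t + 1) ^+ 2)^-1); last by field; rewrite !gt_eqF.
by rewrite invr_ge0 mulr_ge0 ?exprn_ge0// ltW.
Qed.

(** The square of [dot nu] alone has a positive drift, but it is positive
    outside the cone.  The terms in [e] and [K] dominate it at the points
    outside the cone with [dot nu y > 0], and [M] pays for the overshoot at the
    others. *)
Definition boundary_profile nu (e K M : R) N y : R :=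
  let P := dot (fluct N y) (fluct N y) in
  dot nu (real_vec y) ^+ 2 - e * P - K * P ^+ 2 / N%:R ^+ 2 - M.

(** The three last numerical conditions each limit one loss of drift to a
    quarter of the variance: the one due to [e], to the overshoot (controlled
    by [a - M <= a ^+ 2 / (4 * M)] and the fourth moment), and to [K]. *)
Lemma boundary_profile_step nu (e K M : R) s : (0 < s)%N -> dot nu m = 0 ->
  0 < e -> 0 < K -> 0 < M ->
  (forall y, E y -> 0 <= dot nu (real_vec y)) ->
  (forall N y, (0 < N)%N -> ~ E y -> 0 < dot nu (real_vec y) ->
     dot nu (real_vec y) ^+ 2 <= e * dot (fluct N y) (fluct N y)
       + K * dot (fluct N y) (fluct N y) ^+ 2 / N%:R ^+ 2) ->
  e * moment2 <= variance_along nu / 4 ->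
  dot nu nu ^+ 2 / (4 * M) * moment4 <= variance_along nu / 4 ->
  K * (8 * moment2 ^+ 2 + 3 * moment4) <= variance_along nu / 4 * s%:R ->
  forall N y (g : lattice d -> \bar R), (s <= N)%N -> E y ->
    (forall y', E y' -> (0 <= g y')%E) ->
    (forall y', E y' -> ((boundary_profile nu e K M N.+1 y')%:E <= g y')%E) ->
    ((boundary_profile nu e K M N y)%:E <= killed_step mu E g y)%E.
Proof.
move=> s0 num e0 K0 M0 inE_nu outE_nu he hM hs N y g sN Ey g0 Gg.
have N0 : (0 < N)%N by exact: leq_trans s0 sN.
have [T TE] : exists T, T = fluct N y by exists (fluct N y).
pose P := dot T T; pose t : R := N%:R.
have t0 : 0 < t by rewrite ltr0n.
have NE : N.+1%:R = t + 1 :> R by rewrite -natr1.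
have t1 : 0 < t + 1 by lra.
pose k := K / (t + 1) ^+ 2.
have k0 : 0 < k by rewrite divr_gt0// exprn_gt0.
pose Y := dot nu (real_vec y).
have nuT : dot nu T = Y by rewrite TE /fluct !dotE num mulr0 subr0.
pose A := Y ^+ 2 - e * P - k * P ^+ 2 - M.
pose l := (2 * Y) *: nu - (2 * e + 4 * k * P) *: T.
pose b := e + 8 * k * P.
pose c := 3 * k + dot nu nu ^+ 2 / (4 * M).
pose psi := step_form mu A l nu b c.
have nu_xi z : dot nu (real_vec (y + z)) = Y + dot nu (xi z).
  by rewrite real_vecD !dotE num oppr0 addr0.
have c0 : 0 <= dot nu nu ^+ 2 / (4 * M) by rewrite divr_ge0 ?sqr_ge0// mulr_ge0// ltW.
have psi_le z : psi z <= boundary_profile nu e K M N.+1 (y + z)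
     - dot nu nu ^+ 2 / (4 * M) * dot (xi z) (xi z) ^+ 2.
  rewrite /psi /step_form /boundary_profile fluctS -TE nu_xi NE; move: (xi z) => h.
  have := ler_wpM2l (ltW k0) (dot_add_quartic_le T h).
  rewrite [K * _ / _]mulrAC -/k /l /A /b /c !dotE (dotC h T) -/P.
  lra.
apply: (@le_trans _ _ (A + variance_along nu - b * moment2 - c * moment4)%:E);
  last first.
  apply: (killed_step_ge_form (l := l)) => // z Ez; rewrite -/psi.
    apply: le_trans (Gg _ Ez); rewrite lee_fin; apply: le_trans (psi_le z) _.
    by rewrite gerBl mulr_ge0// sqr_ge0.
  apply: le_trans (psi_le z) _; rewrite subr_le0.
  apply: (@le_trans _ _ (dot nu (xi z) ^+ 2 - M)).
    rewrite /boundary_profile; cbv zeta; rewrite lerB// nu_xi.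
    set F := fluct _ _.
    have P0 := dot_ge0 F.
    have eP : 0 <= e * dot F F by rewrite mulr_ge0// ltW.
    have KP : 0 <= K * dot F F ^+ 2 / N.+1%:R ^+ 2.
      by rewrite divr_ge0 ?exprn_ge0// mulr_ge0 ?sqr_ge0// ltW.
    have Y0 : 0 <= Y by exact: inE_nu.
    (* a step crossing the hyperplane is longer than the overshoot *)
    have [Yn|Yp] := leP (Y + dot nu (xi z)) 0.
      apply: (@le_trans _ _ ((Y + dot nu (xi z)) ^+ 2)).
        by rewrite -addrA -opprD gerBl addr_ge0.
      have := mulr_ge0 Y0 (_ : 0 <= - (Y + dot nu (xi z))); rewrite oppr_ge0 => /(_ Yn).
      have := sqr_ge0 Y; rewrite !expr2; lra.
    have := outE_nu N.+1 (y + z) (ltn0Sn N) Ez; rewrite nu_xi => /(_ Yp) out_le.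
    by apply: le_trans (sqr_ge0 _); rewrite -addrA -opprD subr_le0.
  have := dot_sqr_le nu (xi z); set q := dot nu (xi z) ^+ 2 => qle.
  have q0 : 0 <= q by exact: sqr_ge0.
  rewrite mulrAC -exprMn ler_pdivlMr ?mulr_gt0//.
  apply: (@le_trans _ _ (q ^+ 2)).
    have := sqr_ge0 (q - 2 * M); rewrite !expr2; lra.
  by apply: lerXn2r => //; rewrite nnegrE mulr_ge0 ?dot_ge0.
rewrite lee_fin /boundary_profile -TE -/P -/t -/Y.
have a0 := moment2_ge0; have a40 := moment4_ge0.
have P0 : 0 <= P by exact: dot_ge0.
have v0 : 0 <= variance_along nu / 4.
  by apply: divr_ge0 => //; exact: variance_along_ge0.
suff : k * P ^+ 2 + 8 * k * P * moment2 + 3 * k * moment4 <=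
    K * P ^+ 2 / t ^+ 2 + variance_along nu / 4.
  cbv zeta; rewrite -/P; move: (K * P ^+ 2 / t ^+ 2) => W.
  rewrite /A /b /c; move: hM; move: (dot nu nu ^+ 2 / (4 * M)) => D; lra.
(* the decrease of [1 / N ^+ 2] absorbs the quadratic growth of the quartic
   term, by [8 t a P <= 2 P ^+ 2 + 8 (t a) ^+ 2] with [a] the second moment *)
pose br := P ^+ 2 / (t + 1) ^+ 2 - P ^+ 2 / t ^+ 2 +
  (8 * P * moment2 + 3 * moment4) / (t + 1) ^+ 2.
have main : br * t <= 8 * moment2 ^+ 2 + 3 * moment4.
  rewrite -(@ler_pM2r _ ((t + 1) ^+ 2)) ?exprn_gt0//.
  have -> : br * t * (t + 1) ^+ 2 =
      t * (8 * P * moment2 + 3 * moment4) - 2 * P ^+ 2 - P ^+ 2 / t.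
    by rewrite /br; field; rewrite !gt_eqF.
  have h1 := sqr_ge0 (P - 2 * t * moment2).
  have h2 : 0 <= P ^+ 2 / t by rewrite divr_ge0 ?sqr_ge0// ltW.
  have h3 := mulr_ge0 (ltW t0) (sqr_ge0 moment2).
  have h4 := sqr_ge0 moment2.
  have h5 := mulr_ge0 (ltW t0) a40.
  have h6 := mulr_ge0 (ltW t0) h5.
  rewrite !expr2 in h1 h2 h3 h4 h5 h6 *; lra.
have : K * br <= variance_along nu / 4.
  rewrite -(@ler_pM2r _ t)// -mulrA; apply: le_trans (ler_wpM2l (ltW K0) main) _.
  by apply: le_trans hs _; apply: ler_wpM2l => //; rewrite ler_nat.
rewrite /br /k; lra.
Qed.
End Subsolutions.

(** * Consequences of a finite expected lifetime *)

Section FiniteLife.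
Local Open Scope ereal_scope.
Context {R : realType} {d : nat}.
Variables (mu : probability (lattice d) R) (E : set (lattice d)).
Implicit Types (x y z : lattice d) (f g : lattice d -> \bar R) (n k : nat).
Local Notation Q := (killed_step mu E).
Local Notation surv := (survival mu E).

(** When [E] is the set of lattice points of the cone and [x] is in [E], this
    means that [E_x tau] is finite. *)
Definition finite_life x := exists B : R, forall n, \sum_(k < n) surv k x <= B%:E.

Lemma le_iter_killed_step n f g : (forall y, 0 <= f y) -> (forall y, f y <= g y) ->
  forall y, iter n Q f y <= iter n Q g y.
Proof.
move=> f0 fg; elim: n => [//|n IH] y.
by apply: le_killed_step => z _; [exact: iter_killed_step_ge0|exact: IH].
Qed.

Lemma iter_killed_stepD n f g : (forall y, 0 <= f y) -> (forall y, 0 <= g y) ->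
  iter n Q (f \+ g) = iter n Q f \+ iter n Q g.
Proof.
move=> f0 g0; elim: n => [//|n IH]; apply/funext => y /=.
by rewrite IH killed_stepD// => z _; exact: iter_killed_step_ge0.
Qed.

Lemma iter_killed_stepZ n (c : R) f : (0 <= c)%R -> (forall y, 0 <= f y) ->
  iter n Q (fun y => c%:E * f y) = (fun y => c%:E * iter n Q f y).
Proof.
move=> c0 f0; elim: n => [//|n IH]; apply/funext => y /=.
by rewrite IH killed_stepZ// => z _; exact: iter_killed_step_ge0.
Qed.

Lemma iter_survival n k : iter n Q (surv k) = surv (n + k).
Proof. by rewrite /survival iterD. Qed.

Lemma iter_killed_step_sum n k (F : nat -> lattice d -> \bar R) :
  (forall j y, 0 <= F j y) -> forall y,
  iter n Q (fun y => \sum_(j < k) F j y) y = \sum_(j < k) iter n Q (F j) y.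
Proof.
move=> F0; elim: k => [|k IH] y.
  under eq_fun do rewrite big_ord0.
  have := @iter_killed_stepZ n 0 (cst 1) (lexx _) (fun=> lee01).
  under eq_fun do rewrite mul0e.
  by move=> ->; rewrite big_ord0 mul0e.
under eq_fun do rewrite big_ord_recr /=.
rewrite (@iter_killed_stepD n (fun y => \sum_(j < k) F j y) (F k))//.
  by rewrite big_ord_recr /= IH.
by move=> z; apply: sume_ge0.
Qed.

Lemma survival_le1 n y : surv n y <= 1.
Proof.
elim: n y => [//|n IH] y.
have : surv n.+1 y <= \int[mu]_z cst 1 z.
  apply: ge0_le_integral => // z _; first by apply: patch_ge0 => ? _;
    exact: survival_ge0.
  by rewrite patchE; case: ifPn => // _; exact: IH.
by move=> /le_trans; apply; rewrite integral_cst// mul1e probability_le1.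
Qed.

Lemma survival_fin n y : surv n y \is a fin_num.
Proof.
by rewrite ge0_fin_numE ?survival_ge0// (le_lt_trans (survival_le1 n y)) ?ltry.
Qed.

(** One step of positive probability: [mu {z} * P_{x+z} (tau > k)] is at most
    [P_x (tau > k + 1)]. *)
Lemma finite_life_step x z : (0 < mu [set z]) -> E (x + z)%R ->
  finite_life x -> finite_life (x + z)%R.
Proof.
move=> muz Exz [B HB]; pose p := fine (mu [set z]).
have pE : mu [set z] = p%:E by rewrite /p fineK// fin_num_measure.
have p0 : (0 < p)%R by rewrite -lte_fin -pE.
exists (p^-1 * B)%R => n; rewrite EFinM lee_pdivlMl// ge0_sume_distrr; last first.
  by move=> k _; exact: survival_ge0.
apply: le_trans (HB n.+1); rewrite big_ord_recl;
  apply: le_trans (_ : \sum_(i < n) surv i.+1 x <= _).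
  apply: lee_sum => k _; rewrite /= killed_stepE; last by move=> *; exact: survival_ge0.
  rewrite -pE muleC; apply: esum_ge; exists [set (x + z)%R] => //.
  by rewrite fsbig_set1 patchE mem_set// (addrC x z) addrK.
by rewrite leeDr// survival_ge0.
Qed.

Lemma survival_bounded_below x (c : R) : (0 < c)%R ->
  (forall n, c%:E <= surv n x) -> ~ finite_life x.
Proof.
move=> c0 cs [B HB].
have [n nB] : exists n, (B < n%:R * c)%R.
  exists (Num.truncn (B / c)).+1; rewrite -ltr_pdivrMr//; exact: truncnS_gt.
have := HB n; apply/negP; rewrite -ltNge; apply: lt_le_trans (_ : (n%:R * c)%:E <= _).
  by rewrite lte_fin.
have -> : (n%:R * c)%:E = \sum_(k < n) c%:E.
  by rewrite sumEFin sumr_const card_ord mulr_natl.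
exact: lee_sum.
Qed.

Section SquareMoments.
Hypothesis B2 : laplace_finite_near_sublevel mu.
Variable nu : 'rV[R]_d.
Hypothesis num : dot nu (mean mu) = 0%R.
Local Notation Y y := (dot nu (real_vec y)).
Local Notation xi z := (real_vec z - mean mu)%R.

Lemma killed_step_le_form f y A l nu' b c : (forall y, 0 <= f y) ->
  (forall z, f (y + z)%R <= (step_form mu A l nu' b c z)%:E) ->
  Q f y <= (A + variance_along mu nu' - b * moment2 mu - c * moment4 mu)%:E.
Proof.
move=> f0 fle; set psi := step_form mu A l nu' b c in fle.
have psi_int : mu.-integrable setT (EFin \o psi) by exact: step_form_integrable.
rewrite -[X in _ <= X%:E](expect_step_form B2 A l nu' b c) -/psi.
have -> : ((\int[mu]_z psi z)%R%:E = \int[mu]_z (psi z)%:E)%E.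
  by rewrite /Rintegral fineK//; exact: integrable_fin_num.
apply: ge0_le_integral => //.
- by move=> z _; exact: patch_ge0.
- move=> z _; rewrite patchE; case: ifPn => // _.
  exact: le_trans (f0 _) (fle z).
Qed.

Lemma quartic_add_le (s t : R) : ((s + t) ^+ 4 <= 8 * s ^+ 4 + 8 * t ^+ 4)%R.
Proof.
have sq_le (u v : R) : ((u + v) ^+ 2 <= 2 * u ^+ 2 + 2 * v ^+ 2)%R.
  by have := sqr_ge0 (u - v)%R; rewrite !expr2; lra.
rewrite -[4%N]/(2 * 2)%N !exprM.
apply: (@le_trans _ _ ((2 * s ^+ 2 + 2 * t ^+ 2) ^+ 2)%R).
  by apply: lerXn2r; rewrite ?nnegrE ?sqr_ge0 ?sq_le// addr_ge0// mulr_ge0// sqr_ge0.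
by have := sq_le (2 * s ^+ 2)%R (2 * t ^+ 2)%R; rewrite !exprMn; lra.
Qed.

Lemma Y_add y z : Y (y + z)%R = (Y y + dot nu (xi z))%R.
Proof. by rewrite real_vecD !dotE num oppr0 addr0. Qed.

Lemma killed_step_square a y : Q (fun y => ((Y y - a) ^+ 2)%:E) y <=
  ((Y y - a) ^+ 2 + variance_along mu nu)%:E.
Proof.
apply: le_trans (_ : ((Y y - a) ^+ 2 + variance_along mu nu
  - 0 * moment2 mu - 0 * moment4 mu)%R%:E <= _).
  apply: (@killed_step_le_form _ _ _ ((2 * (Y y - a)) *: nu)) => [z|z].
    by rewrite lee_fin sqr_ge0.
  rewrite Y_add /step_form dotZl lee_fin; move: (dot nu (xi z)) => h.
  by rewrite le_eqVlt; apply/orP; left; apply/eqP; ring.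
by rewrite !mul0r !subr0.
Qed.

(** Mean square increment of the stopped martingale [dot nu X]; an inequality
    only, since what has left [E] is dropped on the left. *)
Lemma iter_killed_step_square k a y : iter k Q (fun y => ((Y y - a) ^+ 2)%:E) y <=
  ((Y y - a) ^+ 2)%:E + (variance_along mu nu)%:E * \sum_(j < k) surv j y.
Proof.
have v0 := variance_along_ge0 mu nu.
elim: k y => [|k IH] y; first by rewrite big_ord0 mule0 adde0.
have sq0 y' : 0 <= ((Y y' - a) ^+ 2)%:E by rewrite lee_fin sqr_ge0.
have sum0 y' : 0 <= \sum_(j < k) surv j y' by apply: sume_ge0 => j _;
  exact: survival_ge0.
apply: (@le_trans _ _ (Q (fun y => ((Y y - a) ^+ 2)%:E +
    (variance_along mu nu)%:E * \sum_(j < k) surv j y) y)).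
  by rewrite iterS; apply: le_killed_step => y' _;
    [exact: iter_killed_step_ge0|exact: IH].
rewrite (@killed_stepD _ _ _ _ (fun y => ((Y y - a) ^+ 2)%:E)
   (fun y => (variance_along mu nu)%:E * \sum_(j < k) surv j y)); [|by []|]; last first.
  by move=> y' _; rewrite mule_ge0.
rewrite killed_stepZ//.
apply: le_trans (leeD (killed_step_square a y) (lexx _)) _.
have /= -> := @iter_killed_step_sum 1 k (fun j => surv j)
  (fun j y => survival_ge0 mu E j y) y.
rewrite EFinD -addeA; apply: leeD => //.
rewrite big_ord_recl /= ge0_muleDr ?mule1//.
by apply: sume_ge0 => j _; apply: killed_step_ge0 => ? _; exact: survival_ge0.
Qed.

(** On survival, the value at time [k] is replaced by the initial value [a] at
    the cost of the mean square increment: [Y^2 <= 2 (Y - a)^2 + 2 a^2]. *)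
Lemma iter_killed_step_Y2 k y : iter k Q (fun y => (Y y ^+ 2)%:E) y <=
  (2 * variance_along mu nu)%:E * \sum_(j < k) surv j y + (2 * Y y ^+ 2)%:E * surv k y.
Proof.
have v0 := variance_along_ge0 mu nu.
set a := Y y.
have sq0 y' : 0 <= ((Y y' - a) ^+ 2)%:E by rewrite lee_fin sqr_ge0.
have le2 y' : (Y y' ^+ 2)%:E <= 2%:E * ((Y y' - a) ^+ 2)%:E + (2 * a ^+ 2)%:E * 1.
  rewrite mule1 -EFinM -EFinD lee_fin.
  by have := sqr_ge0 (Y y' - 2 * a)%R; rewrite !expr2; lra.
apply: le_trans (le_iter_killed_step k _ le2 y) _.
  by move=> y'; rewrite lee_fin sqr_ge0.
rewrite (@iter_killed_stepD k (fun y' => 2%:E * ((Y y' - a) ^+ 2)%:E)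
    (fun y' => (2 * a ^+ 2)%:E * (cst 1) y')); last 2 first.
- by move=> y'; rewrite mule_ge0// lee_fin.
- by move=> y'; rewrite mule1 lee_fin mulr_ge0// sqr_ge0.
rewrite (@iter_killed_stepZ k 2)//.
rewrite (@iter_killed_stepZ k (2 * a ^+ 2) (cst 1) _ (fun=> lee01));
  last by rewrite mulr_ge0// sqr_ge0.
apply: leeD => //.
have := iter_killed_step_square k a y; rewrite /a subrr expr0n /= add0e => H.
by rewrite EFinM -muleA; apply: lee_wpmul2l.
Qed.

Lemma iter_killed_step_Y4 m : exists A B : R, [/\ (0 <= A)%R, (0 <= B)%R &
  forall y, iter m Q (fun y => (Y y ^+ 4)%:E) y <= (A * Y y ^+ 4 + B)%:E].
Proof.
have Y40 y : (0 <= Y y ^+ 4)%R by rewrite -[4%N]/(2 * 2)%N exprM sqr_ge0.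
pose D := (8 * dot nu nu ^+ 2)%R.
have D0 : (0 <= D)%R by rewrite mulr_ge0// sqr_ge0.
have step y : Q (fun y => (Y y ^+ 4)%:E) y <= (8 * Y y ^+ 4 + D * moment4 mu)%:E.
  apply: le_trans (_ : (8 * Y y ^+ 4 + variance_along mu 0
    - 0 * moment2 mu - (- D) * moment4 mu)%R%:E <= _).
    apply: (@killed_step_le_form _ _ _ 0) => [z|z]; first by rewrite lee_fin.
    rewrite Y_add /step_form lee_fin.
    have := dot_sqr_le nu (xi z); set h := dot nu (xi z); set q := dot (xi z) (xi z).
    rewrite -(scale0r (0 : 'rV[R]_d)) !dotZl !mul0r => H.
    have h4 : (h ^+ 4 <= dot nu nu ^+ 2 * q ^+ 2)%R.
      rewrite -exprMn -[4%N]/(2 * 2)%N exprM; apply: lerXn2r => //;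
        rewrite nnegrE ?sqr_ge0//.
      by rewrite mulr_ge0 ?dot_ge0.
    have h8 : ((Y y + h) ^+ 4 <= 8 * Y y ^+ 4 + 8 * h ^+ 4)%R.
      exact: quartic_add_le.
    rewrite /D; lra.
  have -> : variance_along mu 0 = 0%R.
    rewrite /variance_along -[RHS](expect_const mu 0); apply: eq_Rintegral => z _.
    by rewrite -(scale0r (0 : 'rV[R]_d)) dotZl mul0r expr0n.
  by rewrite mul0r mulNr opprK addr0 subr0.
have m40 := moment4_ge0 mu.
elim: m => [|m [A [B [A0 B0 IH]]]].
  by exists 1%R, 0%R; split=> // y; rewrite mul1r addr0.
exists (A * 8)%R, (A * D * moment4 mu + B)%R; split.
- by rewrite mulr_ge0.
- by apply: addr_ge0 => //; apply: mulr_ge0 => //; exact: mulr_ge0.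
move=> y; apply: (@le_trans _ _ (Q (fun y => (A * Y y ^+ 4 + B)%:E) y)).
  rewrite iterS; apply: le_killed_step => y' _; last exact: IH.
  by apply: iter_killed_step_ge0 => ?; rewrite lee_fin.
under [X in killed_step mu E X]eq_fun do rewrite EFinD EFinM.
rewrite (@killed_stepD _ _ _ _ (fun y => A%:E * (Y y ^+ 4)%:E) (fun y => B%:E));
  last 2 first.
- by move=> y' _; rewrite -EFinM lee_fin mulr_ge0.
- by move=> y' _; rewrite lee_fin.
rewrite killed_stepZ//; last by move=> y' _; rewrite lee_fin.
have QB : Q (fun=> B%:E) y <= B%:E.
  have := @killed_stepZ _ _ mu E B (cst 1) B0 (fun _ _ => lee01) y.
  under [X in killed_step mu E X]eq_fun do rewrite mule1.
  move=> ->; rewrite -[leRHS]mule1; apply: lee_wpmul2l; first by rewrite lee_fin.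
  exact: (survival_le1 1).
apply: le_trans (leeD (lee_wpmul2l _ (step y)) QB) _; first by rewrite lee_fin.
by rewrite -EFinM -EFinD lee_fin mulrDr !mulrA addrA.
Qed.

(** For [e] small, [m] is chosen so that the tail of the series of survival
    probabilities after [m] is at most [e].  The estimate at time [m + k] is
    then restarted from time [m].  Its second term
    [2 E_x (Y(X_m)^2; tau > m + k)] is small for [k] large by uniform
    integrability, in the form [Y^2 <= L + Y^4 / L] with [L] large. *)
Lemma square_vanishes x (c : R) : (0 < c)%R -> finite_life x ->
  ~ forall n, c%:E <= iter n Q (fun y => (Y y ^+ 2)%:E) x.
Proof.
move=> c0 [B HB] Hc; have v0 := variance_along_ge0 mu nu;
  set v := variance_along mu nu in v0.
pose s k := fine (surv k x).
have sE k : surv k x = (s k)%:E by rewrite fineK// survival_fin.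
have s0 k : (0 <= s k)%R by rewrite -lee_fin -sE survival_ge0.
pose S n := (\sum_(k < n) s k)%R.
have SE n : \sum_(k < n) surv k x = (S n)%:E.
  by rewrite -sumEFin; apply: eq_bigr => k _; rewrite sE.
have SB n : (S n <= B)%R by rewrite -lee_fin -SE.
have hS : has_sup (range S).
  by split; [exists (S 0%N), 0%N|exists B => _ [n _ <-]].
pose e := (c / (8 * (v + 1)))%R.
have e0 : (0 < e)%R by rewrite divr_gt0// mulr_gt0// ltr_wpDl.
have [_ [m _ <-] Sm] := sup_adherent e0 hS.
have tail k : (\sum_(j < k) s (m + j)%N <= e)%R.
  have : (S (m + k)%N <= sup (range S))%R by apply: ub_le_sup;
    [case: hS|exists (m + k)%N].
  rewrite /S big_split_ord /=; rewrite /S in Sm; lra.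
have [A [B' [A0 B'0 Y4]]] := iter_killed_step_Y4 m.
pose W := (A * Y x ^+ 4 + B')%R.
have Y40 y : (0 <= Y y ^+ 4)%R by rewrite -[4%N]/(2 * 2)%N exprM sqr_ge0.
have W0 : (0 <= W)%R by rewrite addr_ge0// mulr_ge0.
pose L := (8 * W / c + 1)%R.
have L0 : (0 < L)%R by rewrite ltr_wpDl// divr_ge0 ?mulr_ge0// ltW.
have key k : (c <= 2 * v * e + 2 * (L * s (m + k)%N + L^-1 * W))%R.
  have := Hc (m + k)%N; rewrite iterD => /le_trans H.
  rewrite -lee_fin; apply: H.
  have surv0 y j : 0 <= surv j y := survival_ge0 mu E j y.
  have sum0 y : 0 <= \sum_(j < k) surv j y by apply: sume_ge0.
  have Y20 y : 0 <= (2 * Y y ^+ 2)%:E * surv k y.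
    by rewrite mule_ge0// lee_fin mulr_ge0// sqr_ge0.
  have vv0 : (0 <= 2 * v)%R by rewrite mulr_ge0.
  apply: le_trans (le_iter_killed_step m _ (iter_killed_step_Y2 k) x) _.
    by move=> y; apply: iter_killed_step_ge0 => ?; rewrite lee_fin sqr_ge0.
  rewrite (@iter_killed_stepD m (fun y => (2 * v)%:E * \sum_(j < k) surv j y)
     (fun y => (2 * Y y ^+ 2)%:E * surv k y))//; last by move=> y; rewrite mule_ge0.
  rewrite EFinD; apply: leeD.
    rewrite (@iter_killed_stepZ m _ (fun y => \sum_(j < k) surv j y))//.
    rewrite (@iter_killed_step_sum m k (fun j => surv j))//.
    rewrite [leRHS]EFinM; apply: lee_wpmul2l; first by rewrite lee_fin.
    rewrite (eq_bigr (fun j : 'I_k => (s (m + j)%N)%:E)); last first.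
      by move=> j _; rewrite iter_survival sE.
    by rewrite sumEFin lee_fin; exact: tail.
  have bound y : (2 * Y y ^+ 2)%:E * surv k y <=
      2%:E * (L%:E * surv k y + L^-1%:E * (Y y ^+ 4)%:E).
    have [p pE p01] : exists2 p, surv k y = p%:E & (0 <= p <= 1)%R.
      exists (fine (surv k y)); first by rewrite fineK// survival_fin.
      by rewrite -!lee_fin fineK ?survival_fin// surv0 survival_le1.
    move/andP: p01 => [p0 p1].
    rewrite pE -!EFinM lee_fin -mulrA; apply: ler_wpM2l => //.
    have [YL|YL] := leP (Y y ^+ 2)%R L.
      apply: ler_wpDr; first by rewrite mulr_ge0// invr_ge0 ltW.
      exact: ler_wpM2r.
    apply: ler_wpDl; first by rewrite mulr_ge0// ltW.
    apply: (@le_trans _ _ (Y y ^+ 2)%R); first by rewrite ler_piMr// sqr_ge0.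
    rewrite ler_pdivlMl// -[4%N]/(2 + 2)%N exprD; apply: ler_wpM2r (ltW YL).
    exact: sqr_ge0.
  apply: le_trans (le_iter_killed_step m Y20 bound x) _.
  have LV : (0 <= L^-1)%R by rewrite invr_ge0 ltW.
  have Lsurv y : 0 <= L%:E * surv k y by rewrite mule_ge0// lee_fin ltW.
  have LY y : 0 <= L^-1%:E * (Y y ^+ 4)%:E by rewrite mule_ge0// lee_fin.
  rewrite (@iter_killed_stepZ m 2
    (fun y => L%:E * surv k y + L^-1%:E * (Y y ^+ 4)%:E))//; last first.
    by move=> y; exact: adde_ge0.
  rewrite (@iter_killed_stepD m (fun y => L%:E * surv k y)
    (fun y => L^-1%:E * (Y y ^+ 4)%:E))//.
  have L00 : (0 <= L)%R by exact: ltW.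
  have Y4E y : 0 <= (Y y ^+ 4)%:E by rewrite lee_fin.
  rewrite !iter_killed_stepZ//.
  rewrite iter_survival sE [leRHS]EFinM; apply: lee_wpmul2l; first by rewrite lee_fin.
  rewrite [leRHS]EFinD; apply: leeD; first by rewrite EFinM.
  by rewrite EFinM; apply: lee_wpmul2l => //; rewrite lee_fin.
have [k sk] : exists k, (s (m + k)%N < c / (8 * L))%R.
  apply: contrapT => nsk.
  have big n : (n%:R * (c / (8 * L)) <= B)%R.
    have := SB (m + n)%N; rewrite /S big_split_ord /=; apply: le_trans.
    apply: ler_wpDl; first exact: sumr_ge0.
    rewrite mulr_natl -[n in (_ *+ n)%R]card_ord -sumr_const; apply: ler_sum => j _.
    by rewrite leNgt; apply/negP => sj; apply: nsk; exists j.
  have q0 : (0 < c / (8 * L))%R by rewrite divr_gt0// mulr_gt0.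
  have := big (Num.truncn (B / (c / (8 * L)))).+1.
  by apply/negP; rewrite -ltNge -ltr_pdivrMr//; exact: truncnS_gt.
have {key} := key k; apply/negP; rewrite -ltNge.
have h1 : (2 * v * e <= c / 4)%R.
  have -> : (c / 4 = 2 * (v + 1) * e)%R by rewrite /e; field; rewrite gt_eqF// ltr_wpDl.
  by rewrite ler_wpM2r// ?ler_wpM2l ?lerDl// ltW.
have h2 : (L * s (m + k)%N < c / 8)%R.
  have : (L * s (m + k)%N < L * (c / (8 * L)))%R by rewrite ltr_pM2l.
  by rewrite (_ : L * (c / (8 * L)) = c / 8)%R//; field; rewrite gt_eqF.
have h3 : (L^-1 * W <= c / 8)%R.
  rewrite ler_pdivrMl// /L mulrDl (_ : 8 * W / c * (c / 8) = W)%R; last by field;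
    rewrite gt_eqF.
  by rewrite lerDl mul1r divr_ge0// ltW.
lra.
Qed.

End SquareMoments.
End FiniteLife.

(** * Infinite expected exit time *)

Section Assembly.
Context {R : realType} {d : nat}.
Variables (mu : probability (lattice d) R) (C : set 'rV[R]_d).
Implicit Types (x y z : lattice d) (a u v w nu : 'rV[R]_d) (t r : R).
Local Notation E := (lattice_points C).
Local Notation m := (mean mu).
Local Notation surv := (survival mu E).
Local Notation life := (finite_life mu E).

Lemma lattice_approx v : exists x, dot (real_vec x - v) (real_vec x - v) <= d%:R.
Proof.
exists (\row_i Num.floor (v ord0 i) : lattice d).
rewrite /dot -[d in d%:R]card_ord -sumr_const; apply: ler_sum => i _.
rewrite !mxE -expr2 -sqrrN opprB.
have := floor_le_tmp (v ord0 i); have := floorD1_gt (v ord0 i).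
rewrite intrD => h1 h2.
by rewrite -[leRHS](expr1n _ 2); apply: lerXn2r; rewrite ?nnegrE; lra.
Qed.

Lemma finite_life_chain x y : chains_of_steps mu C -> E x -> E y -> life x -> life y.
Proof.
move=> [kappa [E0 [_ _ E0mu chain]]] Ex Ey lx.
have [<-//|/eqP xy] := eqVneq x y.
have [n [p [p0 pn _ pE pstep]]] := chain x y Ex Ey xy.
suff H j : (j <= n)%N -> life (p j) by rewrite -pn; exact: H.
elim: j => [|j IH] jn; first by rewrite p0.
rewrite -(subrK (p j) (p j.+1)) addrC; apply: finite_life_step.
- exact/E0mu/pstep.
- by rewrite addrC subrK; exact: pE.
- exact/IH/ltnW.
Qed.

Hypothesis coneC : closed_cone C.
Let scaleC t w : 0 < t -> C w -> C (t *: w). Proof. by case: coneC => _ + _; apply. Qed.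
Let addC v w : C v -> C w -> C (v + w). Proof. by case: coneC => _ _; apply. Qed.
Hypothesis B2 : laplace_finite_near_sublevel mu.

(** By homogeneity: seen from the distance [t], a bounded perturbation of
    [t a] is a small perturbation of [a]. *)
Lemma interior_absorbs a (D : R) : C^° a -> 0 <= D ->
  exists2 t0, 0 < t0 & forall t w, t0 < t -> dot (w - t *: a) (w - t *: a) <= D -> C w.
Proof.
move=> /nbhs_enormP[r r0 rC] D0; exists ((Num.sqrt D + 1) / r).
  by rewrite divr_gt0// ltr_wpDl// sqrtr_ge0.
move=> t w tD wD; have t0 : 0 < t.
  by apply: lt_trans tD; rewrite divr_gt0// ltr_wpDl// sqrtr_ge0.
rewrite -(scale1r w) -(@divff _ t) ?gt_eqF// -scalerA; apply: scaleC => //.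
apply: rC; rewrite -(@ltr_pM2l _ t)// -{1}(gtr0_norm t0) -enormZ scalerBr scalerA.
rewrite divff ?gt_eqF// scale1r.
rewrite ltr_pdivrMr// in tD; apply: le_lt_trans tD.
apply: (@le_trans _ _ (Num.sqrt D)); last by rewrite lerDl.
by rewrite ler_sqrt.
Qed.

Lemma interior_drift_survives : C^° m -> exists2 x, E x & ~ life x.
Proof.
move=> /nbhs_enormP[r r0 rC]; pose rho := r ^+ 2.
have rho0 : 0 < rho by rewrite exprn_gt0.
have out N y : (0 < N)%N -> ~ E y -> rho * N%:R ^+ 2 <= dot (fluct mu N y) (fluct mu N y).
  move=> N0 nEy; rewrite leNgt; apply/negP => lt_out; apply: nEy.
  have n0 : 0 < N%:R :> R by rewrite ltr0n.
  rewrite /lattice_points /= -(scale1r (real_vec y)) -(@divff _ N%:R) ?gt_eqF// -scalerA.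
  apply: scaleC => //; apply: rC.
  rewrite -(@ltr_pM2l _ N%:R)// -{1}(gtr0_norm n0) -enormZ scalerBr scalerA.
  rewrite divff ?gt_eqF// scale1r -/(fluct mu N y).
  rewrite -(@ltr_pXn2r _ 2)// ?nnegrE ?enorm_ge0 ?mulr_ge0//; last exact: ltW.
  by rewrite sqr_enorm exprMn mulrC.
pose K := 2 * (d%:R + moment2 mu) / rho.
have a0 := moment2_ge0 mu.
have K0 : 0 <= K by rewrite divr_ge0 ?mulr_ge0 ?addr_ge0// ltW.
pose s := (Num.truncn K).+1.
have sK : K < s%:R by exact: truncnS_gt.
have s1 : 1 <= s%:R :> R by rewrite ler1n.
have sp : 0 < s%:R :> R by lra.
have d0 : 0 <= d%:R :> R by [].
have KE : d%:R + moment2 mu < rho * s%:R / 2.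
  move: sK; rewrite /K ltr_pdivrMr//; lra.
have [x xd] := lattice_approx (s%:R *: m); rewrite -/(fluct mu s x) in xd.
have ss : rho * s%:R <= rho * s%:R ^+ 2.
  by rewrite ler_pM2l// expr2 ler_peMr.
have rs : 0 < rho * s%:R by rewrite mulr_gt0.
exists x.
  apply: contrapT => nEx; have := out s x isT nEx; lra.
have half : (1 / 2 : R) <= interior_profile mu rho s x.
  rewrite /interior_profile; set F := dot _ _ in xd *.
  suff : (F / s%:R ^+ 2 + moment2 mu / s%:R) / rho <= 1 / 2 by lra.
  rewrite ler_pdivrMr//; apply: (@le_trans _ _ ((d%:R + moment2 mu) / s%:R)).
    rewrite mulrDl lerD2r; apply: (@le_trans _ _ (d%:R / s%:R ^+ 2)).
      by rewrite ler_pM2r// invr_gt0 exprn_gt0.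
    by apply: ler_wpM2l => //; rewrite lef_pV2 ?posrE ?exprn_gt0// expr2 ler_peMr// ltW.
  by rewrite ler_pdivrMr//; lra.
move=> lx; apply: (@survival_bounded_below _ _ mu E x (1 / 2)) lx => // n.
have Ex : E x by apply: contrapT => nEx; have := out s x isT nEx; lra.
apply: le_trans (_ : (interior_profile mu rho s x)%:E <= _)%E; first by rewrite lee_fin.
apply: (@subsolution_le _ _ mu E (cst 1%E) (interior_profile mu rho) s)
  => // [N y sN Ey|N y g sN Ey g0 Gg].
  rewrite lee_fin /interior_profile gerBl divr_ge0 ?addr_ge0 ?divr_ge0 ?dot_ge0 ?exprn_ge0//.
  exact: ltW.
apply: interior_profile_step => //; exact: leq_trans sN.
Qed.

(** Otherwise all possible steps would be orthogonal to [nu], and so would be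
    the difference of any two lattice points of the cone, as they are joined by
    such steps; but [dot nu] is unbounded on the lattice points
    close to the ray of [a]. *)
Lemma variance_pos nu a : chains_of_steps mu C -> dot nu m = 0 -> C^° a -> 0 < dot nu a ->
  0 < variance_along mu nu.
Proof.
move=> chains num Ca nua.
have v0 : 0 <= variance_along mu nu by exact: variance_along_ge0.
rewrite lt_neqAle v0 andbT eq_sym; apply/negP => /eqP var0.
have flat z : (0 < mu [set z])%E -> dot nu (real_vec z) = 0.
  move=> muz; apply/eqP; rewrite -sqrf_eq0 eq_le sqr_ge0 andbT.
  have pE : mu [set z] = (fine (mu [set z]))%:E by rewrite fineK// fin_num_measure.
  have p0 : 0 < fine (mu [set z]) by rewrite -lte_fin -pE.
  rewrite -(pmulr_lle0 _ p0) -lee_fin EFinM -pE.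
  have I0 : (\int[mu]_z ((dot nu (real_vec z - m)) ^+ 2)%:E = 0)%E.
    rewrite -[RHS]/(0%R%:E) -var0 /variance_along /Rintegral fineK//.
    by apply: integrable_fin_num => //; exact: integrable_step_dir.
  apply: (@le_trans _ _ (\int[mu]_z ((dot nu (real_vec z - m)) ^+ 2)%:E)%E);
    last by rewrite I0.
  rewrite integral_lattice; last by move=> y; rewrite lee_fin sqr_ge0.
  apply: esum_ge; exists [set z] => //.
  by rewrite fsbig_set1 !dotE num oppr0 addr0.
have constY x y : E x -> E y -> dot nu (real_vec x) = dot nu (real_vec y).
  have [kappa [E0 [_ _ E0mu chain]]] := chains.
  move=> Ex Ey; have [->//|/eqP xy] := eqVneq x y.
  have [n [p [p0 pn _ pE pstep]]] := chain x y Ex Ey xy.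
  suff H j : (j <= n)%N -> dot nu (real_vec x) = dot nu (real_vec (p j))
    by rewrite -pn; exact: H.
  elim: j => [|j IH] jn; first by rewrite p0.
  rewrite (IH (ltnW jn)) -[in RHS](subrK (p j) (p j.+1)) real_vecD dotDr.
  by rewrite (flat (p j.+1 - p j)) ?add0r//; exact/E0mu/pstep.
have [t0 t00 tC] := interior_absorbs Ca (ler0n R d).
have far B : exists2 x, E x & B < dot nu (real_vec x).
  pose t := Num.max (t0 + 1) ((B + enorm nu * Num.sqrt d%:R + 1) / dot nu a).
  have [x xd] := lattice_approx (t *: a); exists x.
    by apply: (tC t) => //; rewrite lt_max ltrDl ltr01.
  have h : `|dot nu (real_vec x - t *: a)| <= enorm nu * Num.sqrt d%:R.
    apply: le_trans (dot_le_enorm _ _) _; apply: ler_wpM2l; first exact: enorm_ge0.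
    by rewrite ler_sqrt.
  have : (B + enorm nu * Num.sqrt d%:R + 1) / dot nu a <= t by rewrite le_max lexx orbT.
  rewrite ler_pdivrMr//; move: h; rewrite ler_norml => /andP[+ _].
  rewrite dotDr dotNr dotZr; lra.
have [x Ex _] := far 0; have [y Ey] := far (dot nu (real_vec x)).
by rewrite (constY y x)// ltxx.
Qed.

(** The starting point is a lattice point near [s m + t a]: [t] is chosen
    first, so that [nu . x] is large compared with [M] and with [e |T|^2]; then
    [s], which is also the initial time, makes the quartic term and the
    condition on [K] harmless. *)
Lemma boundary_drift_survives nu a : chains_of_steps mu C -> C m ->
  dot nu m = 0 -> (forall w, C w -> 0 <= dot nu w) -> C^° a -> 0 < dot nu a ->
  (forall e, 0 < e -> exists2 r, 0 < r & forall t w, 0 < t -> ~ C w ->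
      enorm (w - t *: m) < r * t -> dot nu w <= e * enorm (w - t *: m)) ->
  exists2 x, E x & ~ life x.
Proof.
move=> chains Cm num nuC Ca nua tangent.
have sig0 := variance_pos chains num Ca nua; set v := variance_along mu nu in sig0.
have a20 := moment2_ge0 mu; have a40 := moment4_ge0 mu.
set a2 := moment2 mu in a20; set a4 := moment4 mu in a40.
have nu0 : 0 < dot nu nu.
  apply: dot_gt0; apply: contraTneq nua => ->.
  by rewrite -(scale0r (0 : 'rV[R]_d)) dotZl mul0r ltxx.
have ap : 0 < dot a a.
  apply: dot_gt0; apply: contraTneq nua => ->.
  by rewrite -(scale0r (0 : 'rV[R]_d)) dotZr mul0r ltxx.
(* the first bound keeps a positive drift, the second makes [e |T|^2] small
   compared with [(nu . x)^2] at the starting point *)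
pose e := Num.min (v / (4 * (a2 + 1))) (dot nu a ^+ 2 / (32 * dot a a)).
have e0 : 0 < e by rewrite lt_min !divr_gt0 ?mulr_gt0 ?exprn_gt0// ltr_wpDl.
have se0 : 0 < Num.sqrt e by rewrite sqrtr_gt0.
have [r r0 rP] := tangent _ se0.
(* for [|T| >= r N] the tangency estimate says nothing, but then
   [(nu . T)^2 <= |nu|^2 |T|^2 <= |nu|^2 |T|^4 / (r N)^2] *)
pose K := dot nu nu / r ^+ 2.
have K0 : 0 < K by rewrite divr_gt0// exprn_gt0.
pose M := dot nu nu ^+ 2 * (a4 + 1) / v.
have M0 : 0 < M by rewrite divr_gt0// mulr_gt0 ?exprn_gt0// ltr_wpDl.
have outE N y : (0 < N)%N -> ~ E y -> 0 < dot nu (real_vec y) ->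
     dot nu (real_vec y) ^+ 2 <= e * dot (fluct mu N y) (fluct mu N y)
       + K * dot (fluct mu N y) (fluct mu N y) ^+ 2 / N%:R ^+ 2.
  move=> N0 nEy Yp; have n0 : 0 < N%:R :> R by rewrite ltr0n.
  have := rP N%:R (real_vec y) n0 nEy; rewrite -/(fluct mu N y).
  have YF : dot nu (real_vec y) = dot nu (fluct mu N y).
    by rewrite /fluct dotDr dotNr dotZr num mulr0 oppr0 addr0.
  move: (fluct mu N y) YF => F YF FP.
  have F0 := dot_ge0 F.
  have [small|large] := ltP (enorm F) (r * N%:R).
    apply: ler_wpDr.
      by apply: divr_ge0; [apply: mulr_ge0; [exact: ltW|exact: sqr_ge0]|exact: sqr_ge0].
    rewrite -sqr_enorm -(sqr_sqrtr (ltW e0)) -exprMn; apply: lerXn2r; rewrite ?nnegrE.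
    - exact: ltW.
    - by rewrite mulr_ge0 ?sqrtr_ge0.
    - exact: FP.
  apply: ler_wpDl; first by rewrite mulr_ge0// ltW.
  rewrite YF; apply: le_trans (dot_sqr_le _ _) _.
  have -> : K * dot F F ^+ 2 / N%:R ^+ 2 =
      dot nu nu * dot F F * (dot F F / (r * N%:R) ^+ 2).
    by rewrite /K; field; rewrite !gt_eqF.
  apply: ler_peMr; first by apply: mulr_ge0 => //; exact: ltW.
  rewrite ler_pdivlMr ?mul1r; last by rewrite exprn_gt0// mulr_gt0.
  by rewrite -sqr_enorm; apply: lerXn2r; rewrite ?nnegrE ?enorm_ge0// mulr_ge0// ltW.
pose D := d%:R : R.
have D0 : 0 <= D by exact: ler0n.
have [t0 t00 tC] := interior_absorbs Ca D0.
have [t [tt0 t0p tlin tquad]] : exists t, [/\ t0 < t, 0 < t,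
    2 * (enorm nu * Num.sqrt D) <= t * dot nu a &
    M + 2 * e * D + 2 <= t ^+ 2 * dot nu a ^+ 2 / 8].
  pose c1 := 2 * (enorm nu * Num.sqrt D) / dot nu a.
  pose c2 := 8 * (M + 2 * e * D + 2) / dot nu a ^+ 2.
  have c10 : 0 <= c1
    by apply: divr_ge0; [rewrite !mulr_ge0 ?enorm_ge0 ?sqrtr_ge0|exact: ltW].
  have eD : 0 <= e * D by rewrite mulr_ge0// ltW.
  have c20 : 0 <= c2 by rewrite divr_ge0 ?sqr_ge0// mulr_ge0//; lra.
  exists (t0 + 1 + c1 + c2); split; [lra|lra| |].
    by rewrite -ler_pdivrMr// -/c1; lra.
  rewrite ler_pdivlMr// [leLHS]mulrC -ler_pdivrMr ?exprn_gt0// -/c2.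
  by apply: (@le_trans _ _ (t0 + 1 + c1 + c2)); [lra|rewrite expr2 ler_peMr//; lra].
pose P0 := 2 * (t ^+ 2 * dot a a) + 2 * D.
pose s := (Num.truncn (Num.max (4 * (K * (8 * a2 ^+ 2 + 3 * a4)) / v) (K * P0 ^+ 2))).+1.
have sp : 1 <= s%:R :> R by rewrite ler1n.
have := truncnS_gt (Num.max (4 * (K * (8 * a2 ^+ 2 + 3 * a4)) / v) (K * P0 ^+ 2)).
rewrite -/s gt_max => /andP[s1 s2].
have [x xd] := lattice_approx (s%:R *: m + t *: a).
pose w := real_vec x - s%:R *: m : 'rV[R]_d.
have wd : dot (w - t *: a) (w - t *: a) <= D.
  by move: xd; rewrite opprD addrA.
have Cw : C w by exact: (tC t).
have Ex : E x.
  rewrite /lattice_points /= -(subrK (s%:R *: m) (real_vec x)); apply: addC => //.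
  by apply: scaleC => //; lra.
exists x => // lx.
apply: (@square_vanishes _ _ mu E B2 nu num x 1 ltr01 lx) => n.
apply: le_trans (_ : (boundary_profile mu nu e K M s x)%:E <= _)%E.
  rewrite lee_fin /boundary_profile; cbv zeta.
  rewrite /fluct -/w.
  have wP0 : dot w w <= P0.
    have := dot_sub_sqr_le (w - t *: a) (- (t *: a));
      rewrite opprK subrK => /le_trans; apply.
    rewrite !dotNl !dotNr opprK dotZl dotZr /P0 expr2; move: wd; lra.
  have Yw : dot nu (real_vec x) = dot nu w.
    by rewrite /w dotDr dotNr dotZr num mulr0 oppr0 addr0.
  have Yt : t * dot nu a / 2 <= dot nu (real_vec x).
    have : `|dot nu (w - t *: a)| <= enorm nu * Num.sqrt D.
      apply: le_trans (dot_le_enorm _ _) _; apply: ler_wpM2l; first exact: enorm_ge0.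
      by rewrite ler_sqrt.
    rewrite ler_norml => /andP[+ _]; rewrite Yw dotDr dotNr dotZr; move: tlin; lra.
  have Ysq : t ^+ 2 * dot nu a ^+ 2 / 4 <= dot nu (real_vec x) ^+ 2.
    rewrite (_ : _ / 4 = (t * dot nu a / 2) ^+ 2); last by field.
    have ta : 0 <= t * dot nu a / 2 by rewrite divr_ge0// mulr_ge0// ltW.
    by apply: lerXn2r; rewrite ?nnegrE// (le_trans ta Yt).
  have eP : e * dot w w <= t ^+ 2 * dot nu a ^+ 2 / 16 + 2 * e * D.
    apply: le_trans (ler_wpM2l (ltW e0) wP0) _.
    have ea : e * dot a a <= dot nu a ^+ 2 / 32.
      have : e <= dot nu a ^+ 2 / (32 * dot a a) by rewrite ge_min lexx orbT.
      rewrite ler_pdivlMr ?mulr_gt0//; lra.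
    have := ler_wpM2l (sqr_ge0 t) ea; rewrite /P0; lra.
  have KP : K * dot w w ^+ 2 / s%:R ^+ 2 <= 1.
    have s0 : 0 < s%:R :> R by lra.
    rewrite ler_pdivrMr ?exprn_gt0// mul1r.
    apply: (@le_trans _ _ (K * P0 ^+ 2)).
      by rewrite ler_pM2l//; apply: lerXn2r;
        rewrite ?nnegrE ?dot_ge0// (le_trans (dot_ge0 w)).
    by apply: le_trans (ltW s2) _; rewrite expr2 ler_peMr// ltW.
  have tq := mulr_ge0 (sqr_ge0 t) (sqr_ge0 (dot nu a)).
  have arith (y2 f k q c M' : R) : q / 4 <= y2 -> f <= q / 16 + c -> M' + c + 2 <= q / 8 ->
    0 <= q -> k <= 1 -> 1 <= y2 - f - k - M' by lra.
  exact: (arith _ _ _ _ _ _ Ysq eP tquad tq KP).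
apply: (@subsolution_le _ _ mu E _ (boundary_profile mu nu e K M) s) => //.
- by move=> y; rewrite lee_fin sqr_ge0.
- move=> N y sN Ey; rewrite lee_fin /boundary_profile; cbv zeta.
  have F0 := dot_ge0 (fluct mu N y); move: (dot (fluct _ _ _) _) F0 => F F0.
  have eF : 0 <= e * F by rewrite mulr_ge0// ltW.
  have KF : 0 <= K * F ^+ 2 / N%:R ^+ 2.
    by apply: divr_ge0; [apply: mulr_ge0; [exact: ltW|exact: sqr_ge0]|exact: sqr_ge0].
  by rewrite -!addrA gerDl -!opprD oppr_le0 !addr_ge0// ltW.
move=> N y g sN Ey g0 Gg; apply: (@boundary_profile_step _ _ mu E B2 nu e K M s) => //.
- by move=> y' Ey'; exact: nuC.
- rewrite -/a2 -/v; apply: (@le_trans _ _ (v / (4 * (a2 + 1)) * a2)).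
    by apply: ler_wpM2r => //; rewrite ge_min lexx.
  rewrite mulrAC ler_pdivrMr ?mulr_gt0 ?ltr_wpDl//; lra.
- rewrite -/a4 -/v.
  have -> : dot nu nu ^+ 2 / (4 * M) * a4 = v / 4 * (a4 / (a4 + 1)).
    by rewrite /M; field; rewrite !gt_eqF// ltr_wpDl.
  by apply: ler_piMr;
    [rewrite divr_ge0// ltW|rewrite ler_pdivrMr ?mul1r ?lerDl// ltr_wpDl].
- rewrite -/a2 -/a4 -/v; rewrite ltr_pdivrMr// in s1; lra.
Qed.

End Assembly.

Theorem theorem5 (R : realType) (d : nat) (mu : probability (lattice d) R)
    (disp : measure_display) (Omega : measurableType disp)
    (P : lattice d -> probability Omega R)
    (X : nat -> {mfun Omega >-> lattice d}) (C : set 'rV[R]_d)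
    (walkX : random_walk mu P X)
    (B0 : closed_solid_cone C)
    (B1_transient : killed_walk_transient C X P)
    (B1_chains : chains_of_steps mu C)
    (B2 : laplace_finite_near_sublevel mu)
    (B3 : mean mu != 0)
    (C1_boundary : C1_sphere_hypersurface (sphere_boundary (C `&` sphere)))
    (mean_in_C : C (mean mu)) :
  forall x, lattice_points C x -> (\int[P x]_w exit_time C X w = +oo)%E.
Proof.
have coneC := closed_solid_cone_closed B0.
have [x0 Ex0 inf_x0] : exists2 x, lattice_points C x &
    ~ finite_life mu (lattice_points C) x.
  have [int_m|not_int] := pselect (C^° (mean mu)).
    exact: interior_drift_survives.
  have [nu [num nuC [a Ca nua] tangent]] := tangent_halfspace coneC C1_boundary
    (closed_solid_cone_interior B0) B3 mean_in_C not_int.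
  exact: (boundary_drift_survives coneC B2 B1_chains mean_in_C num nuC Ca nua tangent).
move=> x Ex; apply: contrapT => fin_x; apply: inf_x0.
apply: (finite_life_chain B1_chains Ex Ex0).
have int0 : (0 <= \int[P x]_w exit_time C X w)%E.
  by apply: integral_ge0 => w _; exact: exit_time_ge0.
exists (fine (\int[P x]_w exit_time C X w)%E) => n; rewrite fineK.
  exact: (sum_survival_le_exit walkX).
by rewrite ge0_fin_numE// ltey; apply/eqP.
Qed.
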